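(* Suppose $\Delta$ is of type $\mathsf A$, $\mathsf D$ or $\mathsf E$ (all roots of the same length), and consider the extra-special case. Then (i) for every $\mu\in\Delta(0)$ there is a unique two-element antichain $\{\gamma_1,\gamma_2\}$ of $\Delta(1)$ with $\gamma_1+\gamma_2-\theta=\mu$ (and it satisfies $(\gamma_1,\gamma_2)=0$); (ii) the number of two-element antichains $\{\gamma_1,\gamma_2\}$ of $\Delta(1)$ with $\gamma_1+\gamma_2=\theta$ equals $\operatorname{rk}\mathfrak g-1$. In particular, the map $\{\gamma_1,\gamma_2\}\mapsto\gamma_1+\gamma_2-\theta$ from the set of two-element antichains of $\Delta(1)$ to $\Delta(0)\cup\{0\}$ is onto, and the number $N_2$ of two-element antichains of $\Delta(1)$ equals $\dim\mathfrak g(0)-1$.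
   Context: Let $\mathfrak g$ be a complex simple Lie algebra with Cartan subalgebra $\mathfrak t$, root system $\Delta$ in a real Euclidean space with $W$-invariant inner product $(\,,\,)$, simple roots $\Pi$ ($\operatorname{rk}\mathfrak g=\#\Pi$), highest root $\theta$, $\theta^\vee=2\theta/(\theta,\theta)$. Extra-special case: $\Delta(j)=\{\gamma\in\Delta:(\gamma,\theta^\vee)=j\}$; $\mathfrak g(0)=\mathfrak t\oplus\bigoplus_{\gamma\in\Delta(0)}\mathfrak g_\gamma$, so $\dim\mathfrak g(0)=\operatorname{rk}\mathfrak g+\#\Delta(0)$; $\Pi(0)=\Pi\cap\Delta(0)$; $\Delta(1)$ is partially ordered by $\mu\preccurlyeq\gamma$ iff $\gamma-\mu$ is a nonnegative integer combination of $\Pi(0)$.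
   Formalization: The surjectivity of the map onto Δ(0)∪{0} is stated only for rk g > 1: for g = sl_2 (type A_1) both Δ(1) and Δ(0) are empty, so there are no antichains and the map cannot reach 0; all other claims are stated for every rank. *)

(* Defs.v *)
From HB Require Import structures.
From mathcomp Require Import all_boot all_order all_algebra.
From mathcomp Require Import finmap.
From mathcomp Require Import boolp reals.
From mathcomp Require Import complex.

Set Implicit Arguments.
Unset Strict Implicit.
Unset Printing Implicit Defensive.

Import Order.TTheory GRing.Theory Num.Theory.
Local Open Scope fset_scope.
Local Open Scope ring_scope.

Notation dual K t := 'Hom(subvs_of t, K^o).

Section LieAlgebra.
Variables (K : fieldType) (g : vectType K).
Implicit Types (br : g -> g -> g) (t : {vspace g}).

Definition lie_bracket br : Prop :=
  [/\ forall (a : K) (x y z : g), br (a *: x + y) z = a *: br x z + br y z,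
      forall (a : K) (x y z : g), br z (a *: x + y) = a *: br z x + br z y,
      forall x : g, br x x = 0
    & forall x y z : g, br x (br y z) + br y (br z x) + br z (br x y) = 0].

Definition lie_ideal br (I : {vspace g}) : Prop :=
  forall x y : g, y \in I -> br x y \in I.

Definition simple_lie_algebra br : Prop :=
  [/\ lie_bracket br,
      exists x y : g, br x y <> 0
    & forall I : {vspace g}, lie_ideal br I -> I = 0%VS \/ I = fullv].

Definition ad_diagonalizable br (h : g) : Prop :=
  exists2 b : seq g, basis_of fullv b &
    forall x : g, x \in b -> exists a : K, br h x = a *: x.

(* The definition of a Cartan subalgebra usual for complex semisimple Lie
   algebras: abelian, self-centralizing, acting diagonalizably. *)
Definition cartan_subalgebra br t : Prop :=
  [/\ forall x y : g, x \in t -> y \in t -> br x y = 0,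
      forall x : g, (forall h : g, h \in t -> br h x = 0) -> x \in t
    & forall h : g, h \in t -> ad_diagonalizable br h].

(* The weight space {x | [h, x] = la(h) x for all h in t}, as a subspace:
   it is enough to let h range over a basis of t; see root_spaceP. *)
Definition root_space br t (la : dual K t) : {vspace g} :=
  (\bigcap_(h <- vbasis t)
     lker (linfun (fun x : g => br h x - la (vsproj t h) *: x)))%VS.

Lemma root_spaceP br t (la : dual K t) (x : g) : lie_bracket br ->
  x \in root_space br la <->
  forall h : subvs_of t, br (vsval h) x = la h *: x.
Proof.
case=> brl brr _ _.
have kerP h y :
    (y \in lker (linfun (fun x : g => br h x - la (vsproj t h) *: x)))
    = (br h y == la (vsproj t h) *: y).
  pose f (z : g) := br h z - la (vsproj t h) *: z.
  have lf : linear f.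
    move=> a u v; rewrite /f brr scalerDr scalerBr !scalerA [a * _]mulrC.
    by rewrite opprD addrACA.
  pose F : {linear g -> g} := HB.pack f (GRing.isLinear.Build _ _ _ _ f lf).
  by rewrite memv_ker (lfunE F) /= /f subr_eq0.
have capP (s : seq g) :
    (x \in (\bigcap_(h <- s)
       lker (linfun (fun x : g => br h x - la (vsproj t h) *: x)))%VS)
    = all (fun h => br h x == la (vsproj t h) *: x) s.
  elim: s => [|h s IHs]; first by rewrite big_nil memvf.
  by rewrite big_cons memv_cap kerP IHs.
have br0 : br 0 x = 0.
  have /eqP := brl 1 0 0 x; rewrite !scale1r addr0 -subr_eq0 opprD.
  by rewrite addNKr oppr_eq0 => /eqP.
rewrite /root_space capP; split=> [/allP xP h | xP]; last first.
  apply/allP=> h /vbasis_mem th; apply/eqP.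
  by rewrite -xP vsprojK.
have th : vsval h \in t by exact: (valP h).
pose c i := coord (vbasis t) i (vsval h).
have hE : vsval h = \sum_(i < \dim t) c i *: (vbasis t)`_i by exact: coord_vbasis.
have -> : h = \sum_(i < \dim t) c i *: vsproj t (vbasis t)`_i.
  apply: val_inj; rewrite [LHS]hE [RHS]linear_sum; apply: eq_bigr => i _.
  by rewrite linearZ /= vsprojK // vbasis_mem // mem_nth // size_tuple.
rewrite !linear_sum /= scaler_suml.
elim/big_rec2: _ => [|i y z _ IH]; first by rewrite br0.
rewrite !linearZ /= brl IH vsprojK; last first.
  by rewrite vbasis_mem // mem_nth // size_tuple.
have /xP/eqP -> : (vbasis t)`_i \in (vbasis t : seq g).
  by rewrite mem_nth // size_tuple.
by rewrite !scalerA.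
Qed.

End LieAlgebra.

Section RootSystem.
Variables (R : realType) (E : vectType R) (ip : E -> E -> R).
Implicit Types (Delta Pi S : {fset E}) (theta : E).

Definition inner_product : Prop :=
  [/\ forall (a : R) (u v w : E), ip (a *: u + v) w = a * ip u w + ip v w,
      forall u v : E, ip u v = ip v u
    & forall u : E, u != 0 -> 0 < ip u u].

Definition coroot (u : E) : E := (2 / ip u u) *: u.

Definition reflection (u v : E) : E := v - ip v (coroot u) *: u.

(* The reflections are taken with respect to ip, so that ip is invariant under
   the Weyl group. *)
Definition root_system Delta : Prop :=
  [/\ <<Delta>>%VS = fullv /\ 0 \notin Delta,
      forall u v : E, u \in Delta -> v \in Delta -> reflection u v \in Delta,
      forall u v : E, u \in Delta -> v \in Delta ->
        ip v (coroot u) \is a Num.int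
    & forall (u : E) (a : R), u \in Delta -> a *: u \in Delta ->
        a = 1 \/ a = -1].

Definition simply_laced Delta : Prop :=
  forall u v : E, u \in Delta -> v \in Delta -> ip u u = ip v v.

Definition nat_comb S (v : E) : Prop :=
  exists c : E -> nat, v = \sum_(a <- S) a *+ c a.

Definition simple_roots Delta Pi : Prop :=
  [/\ Pi `<=` Delta, free Pi
    & forall u : E, u \in Delta -> nat_comb Pi u \/ nat_comb Pi (- u)].

Definition highest_root Delta Pi theta : Prop :=
  theta \in Delta /\ forall u : E, u \in Delta -> nat_comb Pi (theta - u).

Definition graded_roots Delta theta (j : int) : {fset E} :=
  [fset u in Delta | ip u (coroot theta) == j%:~R].

Definition root_le Delta Pi theta (m u : E) : Prop :=
  nat_comb (Pi `&` graded_roots Delta theta 0) (u - m).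

Definition antichain Delta Pi theta (A : {fset E}) : Prop :=
  A `<=` graded_roots Delta theta 1 /\
  forall m u : E, m \in A -> u \in A -> root_le Delta Pi theta m u -> m = u.

Definition antichains2 Delta Pi theta : {fset {fset E}} :=
  [fset A in fpowerset (graded_roots Delta theta 1) |
     `[< antichain Delta Pi theta A >] && (#|` A| == 2%N)].

Definition antichain_map theta (A : {fset E}) : E := \sum_(u <- A) u - theta.

End RootSystem.

Section RootsOfLieAlgebra.
Local Open Scope complex_scope.
Variables (R : realType) (g : vectType R[i]) (E : vectType R).

(* The real-linear map wt identifies E with the real span, in the dual of the
   Cartan subalgebra t, of the roots of (g, t), and Delta with the set of
   these roots. *)
Definition roots_of_lie_algebra (br : g -> g -> g) (t : {vspace g})
    (Delta : {fset E}) (wt : E -> dual R[i] t) : Prop :=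
  [/\ forall (a : R) (u v : E), wt (a *: u + v) = a%:C *: wt u + wt v,
      injective wt
    & forall la : dual R[i] t,
        (la != 0 /\ root_space br la != 0%VS) <->
        (exists2 u : E, u \in Delta & wt u = la)].

Definition lie_degree0 (ip : E -> E -> R) (br : g -> g -> g) (t : {vspace g})
    (Delta : {fset E}) (wt : E -> dual R[i] t) (theta : E) : {vspace g} :=
  (t + \sum_(u <- graded_roots ip Delta theta 0) root_space br (wt u))%VS.

End RootsOfLieAlgebra.

(* Main.v *)
From HB Require Import structures.
Require Import Defs.
From mathcomp Require Import all_boot all_order all_algebra.
From mathcomp Require Import finmap boolp reals complex.
From mathcomp Require Import zify ring lra.

Set Implicit Arguments.
Unset Strict Implicit.
Unset Printing Implicit Defensive.

Import Order.TTheory GRing.Theory Num.Theory.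
Import passmx.
Local Open Scope fset_scope.
Local Open Scope ring_scope.

(* Root combinatorics. Normalize the pairing so that roots have norm 2. For mu
   of degree 0, the roots u of degree 1 with (u, mu) = 1 are paired by
   u |-> theta + mu - u; two unpaired ones have pairing 1, so they differ by a
   root and are comparable, which leaves at most one incomparable pair. Simple
   reflections of degree 0 preserve incomparable pairs, so existence is only
   needed for mu dominant; there, a comparable pair u < theta + mu - u can be
   shrunk by a simple root orthogonal to mu until it is incomparable.

   For (ii), call a splitting of a positive root nu an incomparable pair of
   positive roots of sum nu. If a is simple and (nu, a) = -1, the reflection in
   a maps the splittings of nu to those of nu + a; the only other decomposition
   of nu + a is {a, nu}, which is incomparable exactly when a is not in the
   support of nu. So nu has #(supp nu) - 1 splittings; theta has full support.

   Dimension of g(0). In a basis of weight vectors, the trace of [e, f] on a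
   string of weight spaces shows that every weight is a real multiple of la on
   [g_la, g_-la]. This makes the Killing form nondegenerate, the root spaces
   one-dimensional, and the simple roots linearly independent over R[i]. *)

(** * Simultaneous diagonalization of endomorphisms *)

Section Codiagonalization.
Variables (K : fieldType) (V : vectType K).

(** The rows of [P] are the coordinates of the eigenvectors; the opposite change of basis [Q] shows
    that [P] is invertible. *)
Lemma eigenbasis_diagonalizable (f : 'End(V)) (b : seq V) :
  basis_of fullv b -> (forall x, x \in b -> exists a : K, f x = a *: x) ->
  diagonalizable (mxof (vbasis {:V}) (vbasis {:V}) f).
Proof.
move=> bb bE; set e := vbasis _; have eb : basis_of {:V} e := vbasisP _.
have sb : size b == \dim {:V}.
  by rewrite (@size_basis _ _ _ _ (in_tuple b)).
pose t := Tuple sb; have tb : basis_of {:V} t by [].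
pose P : 'M_(\dim {:V}) := \matrix_i rVof e t`_i.
pose Q : 'M_(\dim {:V}) := \matrix_i rVof t e`_i.
have PQ : P *m Q = 1%:M.
  apply/matrixP=> i k; rewrite !mxE.
  rewrite -(coord_free i k (basis_free tb))
    [in RHS](coord_basis eb (memvf t`_i)).
  rewrite linear_sum; apply: eq_bigr => j _.
  by rewrite linearZ /= !mxE.
have /mulmx1_unit[uP _] := PQ.
exists P => //; apply/diagonalizable_forP => // i j ij.
have /bE [a fa] : t`_i \in b by rewrite mem_nth ?size_tuple.
have -> : (P *m mxof e e f *m invmx P) i j =
          (row i (P *m mxof e e f *m invmx P)) 0 j by rewrite [RHS]mxE.
rewrite !row_mul.
have -> : row i P = rVof e t`_i by rewrite rowK.
rewrite -rVof_app // fa linearZ /= -scalemxAl.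
have -> : rVof e t`_i = row i P by rewrite rowK.
rewrite -row_mul mulmxV // !mxE.
by rewrite (negPf (ij : i != j)) mulr0.
Qed.

(** Commuting diagonalizable matrices are simultaneously diagonalizable; the rows of the
    diagonalizing matrix, read as vectors, are the common eigenbasis. *)
Lemma codiagonalization (s : seq 'End(V)) :
  (forall f k, f \in s -> k \in s -> forall x, f (k x) = k (f x)) ->
  (forall f, f \in s -> exists2 b, basis_of {:V} b &
     forall x, x \in b -> exists a : K, f x = a *: x) ->
  exists2 b : (\dim {:V}).-tuple V, basis_of {:V} b &
    forall (i : 'I_(\dim {:V})) f, f \in s -> exists a : K, f b`_i = a *: b`_i.
Proof.
move=> comm diag; set e := vbasis {:V}; have eb : basis_of {:V} e := vbasisP _.
have /codiagonalizableP [P uP /allP PD] :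
  {in map (mxof e e) s &, forall A B, comm_mx A B} /\
  {in map (mxof e e) s, forall A, diagonalizable A}.
  split=> [_ _ /mapP[f fs ->] /mapP[k ks ->] | _ /mapP[f fs ->]].
    rewrite /comm_mx -!mxof_comp //; congr mxof.
    by apply/lfunP=> x; rewrite !lfunE /= comm.
  by have [b bb bE] := diag f fs; apply: eigenbasis_diagonalizable bb bE.
pose b := [tuple vecof e (row i P) | i < \dim {:V}].
have bE (i : 'I__) : b`_i = vecof e (row i P).
  by rewrite -tnth_nth tnth_mktuple.
exists b; last first.
  move=> i f fs; exists ((P *m mxof e e f *m invmx P) i i).
  rewrite bE -[f _](rVofK eb) (rVof_app e eb) vecofK // -row_mul.
  rewrite -linearZ; congr (vecof _ _).
  have /PD/diagonalizable_forP - /(_ uP) D : mxof e e f \in map (mxof e e) s.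
    exact: map_f.
  rewrite -{1}[P *m _](mulmxKV uP).
  move: (P *m _ *m _) D => M D.
  apply/rowP=> j; rewrite !mxE (bigD1 i) //=.
  rewrite big1 ?addr0 // => k ki.
  by rewrite D 1?eq_sym ?mul0r.
rewrite basisEfree subvf size_tuple leqnn !andbT.
apply/freeP => c c0 i.
have : (\row_i c i) *m P = 0.
  apply: (can_inj (vecofK eb)) => /=; rewrite [RHS]linear0 -c0.
  rewrite mulmx_sum_row linear_sum; apply: eq_bigr => j _.
  by rewrite bE linearZ mxE.
move/(congr1 (mulmxr (invmx P))); rewrite /= mulmxK // mul0mx.
by move/rowP/(_ i); rewrite !mxE.
Qed.

End Codiagonalization.

(** * Weight spaces *)

Section LieBracket.
Variables (K : fieldType) (g : vectType K) (br : g -> g -> g).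
Hypothesis hb : lie_bracket br.

Lemma br_linear x : linear (br x).
Proof. by case: hb => _ h _ _ a y z; exact: h. Qed.

Definition ad (x : g) : 'End(g) :=
  linfun (HB.pack (br x) (GRing.isLinear.Build _ _ _ _ (br x) (br_linear x)) :
    {linear g -> g}).

Lemma adE x y : ad x y = br x y.
Proof. by rewrite /ad lfunE. Qed.

Lemma br_anti x y : br x y = - br y x.
Proof.
case: hb => hl hr h0 _; have := h0 (1 *: x + y); rewrite hl !hr !h0 !scale1r.
by rewrite add0r addr0 => /eqP; rewrite addr_eq0 => /eqP.
Qed.

Lemma brx0 x : br x 0 = 0. Proof. by rewrite -adE linear0. Qed.
Lemma br0x x : br 0 x = 0. Proof. by rewrite br_anti brx0 oppr0. Qed.
Lemma brZr a x y : br x (a *: y) = a *: br x y.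
Proof. by rewrite -!adE linearZ. Qed.
Lemma brZl a x y : br (a *: x) y = a *: br x y.
Proof. by rewrite br_anti brZr -scalerN -br_anti. Qed.
Lemma brBl x y z : br (x - y) z = br x z - br y z.
Proof.
rewrite br_anti -adE linearB /= !adE [br x z]br_anti [br y z]br_anti.
by rewrite opprB opprK addrC.
Qed.
Lemma br_sumr I (r : seq I) P (F : I -> g) x :
  br x (\sum_(i <- r | P i) F i) = \sum_(i <- r | P i) br x (F i).
Proof. by rewrite -adE linear_sum; apply: eq_bigr => i _; exact: adE. Qed.
Lemma br_suml I (r : seq I) P (F : I -> g) x :
  br (\sum_(i <- r | P i) F i) x = \sum_(i <- r | P i) br (F i) x.
Proof.
by rewrite br_anti br_sumr -sumrN; apply: eq_bigr => i _; rewrite -br_anti.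
Qed.

Lemma br_jacobi x y z : br x (br y z) = br (br x y) z + br y (br x z).
Proof.
case: hb => _ _ _ /(_ x y z)/eqP; rewrite -addrA addr_eq0 => /eqP ->.
rewrite [br z x]br_anti -[br y (- _)]adE linearN /= adE [br z _]br_anti.
by rewrite opprD !opprK addrC.
Qed.

(** A subspace containing all brackets is an ideal, and it is nonzero because some bracket is. *)
Lemma ideal_of_brackets (I : {vspace g}) : simple_lie_algebra br ->
  (forall x y, br x y \in I) -> I = fullv.
Proof.
case=> _ [x [y xy]] sI I_br;
have [|I0|//] := sI I; first by move=> x' y' _; exact: I_br.
by have := I_br x y; rewrite I0 memv0 => /eqP.
Qed.

(** The line through a central [x] is an ideal; were it everything, the bracket would vanish. *)
Lemma center0 x : simple_lie_algebra br -> (forall y, br y x = 0) -> x = 0.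
Proof.
case=> _ [y [z yz]] sI x0; case: (sI <[x]>%VS).
- by move=> y' _ /vlineP[a ->]; rewrite brZr x0 scaler0 mem0v.
- by move/eqP; rewrite -subv0 => /subvP/(_ x (memv_line x));
  rewrite memv0 => /eqP.
move=> xf; case: yz; have /vlineP[a ->] : z \in <[x]>%VS by rewrite xf memvf.
by rewrite brZr x0 scaler0.
Qed.

End LieBracket.

(** * Traces on spans of basis vectors *)

Section PartialTrace.
Variables (K : fieldType) (V : vectType K) (n : nat) (b : n.-tuple V).
Hypothesis bb : basis_of {:V} b.

(** Stability of the span of the basis vectors selected by [P], stated on coordinates; [ptrace] is
    then the trace of the restriction. *)
Definition basis_stable (P : pred 'I_n) (f : 'End(V)) :=
  forall i j, P i -> coord b j (f b`_i) != 0 -> P j.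

Definition ptrace (P : pred 'I_n) (f : 'End(V)) :=
  \sum_(i | P i) coord b i (f b`_i).

Lemma basis_coordE x : x = \sum_i coord b i x *: b`_i.
Proof. exact: coord_basis bb (memvf x). Qed.

(** By stability no coordinate outside [P] contributes, so both sides are the same double sum over
    [P]. *)
Lemma ptraceC P (f k : 'End(V)) : basis_stable P f -> basis_stable P k ->
  ptrace P (f \o k)%VF = ptrace P (k \o f)%VF.
Proof.
have tE (f1 k1 : 'End(V)) : basis_stable P k1 -> ptrace P (f1 \o k1)%VF =
    \sum_(i | P i) \sum_(j | P j) coord b j (k1 b`_i) * coord b i (f1 b`_j).
  move=> sk; apply: eq_bigr => i Pi; rewrite lfunE /= {1}[k1 _]basis_coordE.
  rewrite !linear_sum (bigID P) /= [X in _ + X]big1 ?addr0 => [|j Pj].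
    by apply: eq_bigr => j _; rewrite !linearZ.
  have [->|/(sk _ _ Pi)] := eqVneq (coord b j (k1 b`_i)) 0.
    by rewrite scale0r !linear0.
  by rewrite (negPf Pj).
move=> sf sk; rewrite !tE // exchange_big; apply: eq_bigr => i _.
by apply: eq_bigr => j _; rewrite mulrC.
Qed.

Lemma ptraceB P (f k : 'End(V)) : ptrace P (f - k) = ptrace P f - ptrace P k.
Proof.
rewrite -sumrB; apply: eq_bigr => i _.
by rewrite add_lfunE opp_lfunE linearB.
Qed.

End PartialTrace.

Section Weights.
Variables (K : numFieldType) (g : vectType K) (br : g -> g -> g).
Variable (t : {vspace g}).
Hypotheses (hs : simple_lie_algebra br) (ht : cartan_subalgebra br t).

Let hb : lie_bracket br. Proof. by case: hs. Qed.

(** Since [t] is abelian, the Jacobi identity makes the maps [ad h] commute; a common eigenbasis for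
    a basis of [t] serves all of [t]. *)
Lemma weight_basis : exists n (b : n.-tuple g) (w : 'I_n -> dual K t),
  basis_of {:g} b /\
  forall (i : 'I_n) (h : subvs_of t), br (vsval h) b`_i = w i h *: b`_i.
Proof.
case: ht => tab _ tdiag.
have [|f /mapP[h hv ->]|b bb bE] :=
  @codiagonalization _ g [seq ad hb h | h <- vbasis t].
- move=> _ _ /mapP[h hv ->] /mapP[k kv ->] x; rewrite !adE (br_jacobi hb).
  by rewrite (tab h k) ?vbasis_mem // (br0x hb) add0r.
- have [b bb bE] := tdiag h (vbasis_mem hv); exists b => // x /bE[a xa].
  by exists a; rewrite adE.
have wP (i : 'I_(\dim {:g})) (h : subvs_of t) :
    exists a, br (vsval h) b`_i = a *: b`_i.
  have /coord_vbasis -> : vsval h \in t by exact: (valP h).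
  rewrite (br_suml hb).
  have aP j : exists a, br (vbasis t)`_j b`_i = a *: b`_i.
    (* An index beyond the basis gives the default vector 0, with eigenvalue 0. *)
    have [jt|jt] := ltnP j (\dim t); last first.
      by rewrite nth_default ?size_tuple // (br0x hb); exists 0;
        rewrite scale0r.
    have [|a] := bE i (ad hb (vbasis t)`_j).
      by apply: map_f; rewrite mem_nth ?size_tuple.
    by rewrite adE; exists a.
  have [a aE] := choice aP.
  exists (\sum_(j < \dim t) coord (vbasis t) j (vsval h) * a j).
  by rewrite scaler_suml; apply: eq_bigr => j _; rewrite (brZl hb) aE scalerA.
(* Reading the eigenvalue off as a coordinate makes it linear in [h]. *)
pose wf (i : 'I_(\dim {:g})) (h : subvs_of t) : K^o :=
  coord b i (br (vsval h) b`_i).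
have wl i : linear (wf i).
  move=> a u v; rewrite /wf; case: hb => -> _ _ _.
  by rewrite linearP.
pose wL i : {linear subvs_of t -> K^o} :=
  HB.pack (wf i) (GRing.isLinear.Build _ _ _ _ (wf i) (wl i)).
exists _, b, (fun i => linfun (wL i)); split=> // i h; rewrite lfunE /= /wf.
have [a ->] := wP i h; congr (_ *: _).
by rewrite linearZ /= coord_free ?(basis_free bb) // eqxx mulr1.
Qed.

Definition weight (la : dual K t) (x : g) :=
  forall h : subvs_of t, br (vsval h) x = la h *: x.

Lemma weight0P x : weight 0 x <-> x \in t.
Proof.
case: ht => tab tself _; split=> [x0|xt h].
  apply: tself => h th; have := x0 (vsproj t h).
  by rewrite vsprojK // lfunE /= scale0r.
by rewrite lfunE /= scale0r tab //; exact: (valP h).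
Qed.

Lemma weight_br la mu x y : weight la x -> weight mu y ->
  weight (la + mu) (br x y).
Proof.
move=> xla ymu h; rewrite (br_jacobi hb) xla ymu (brZl hb) (brZr hb).
by rewrite -scalerDl lfunE.
Qed.

Lemma weightB la x y : weight la x -> weight la y -> weight la (x - y).
Proof.
by move=> xla yla h; rewrite -(adE hb) linearB /= !adE xla yla scalerBr.
Qed.

Lemma weightZ la a x : weight la x -> weight la (a *: x).
Proof. by move=> xla h; rewrite (brZr hb) xla !scalerA mulrC. Qed.

Variables (n : nat) (b : n.-tuple g) (w : 'I_n -> dual K t).
Hypotheses (bb : basis_of {:g} b).
Hypothesis bw : forall i, weight (w i) b`_i.

(** A weight vector involves only basis vectors of its own weight: compare the coordinates at [i] of
    both expressions for [[h, x]]. *)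
Lemma weight_coord la x i : weight la x -> coord b i x != 0 -> w i = la.
Proof.
move=> xla xi; apply/lfunP => h.
have : coord b i (br (vsval h) x) = coord b i (la h *: x) by rewrite xla.
rewrite {1}(basis_coordE bb x) (br_sumr hb) linearZ /= linear_sum /=.
rewrite (eq_bigr (fun j => coord b j x * w j h * (i == j)%:R)) => [|j _].
  rewrite (bigD1 i) //= eqxx mulr1 big1 ?addr0 => [|j ji].
    by rewrite mulrC => /(mulIf xi).
  by rewrite eq_sym (negPf ji) mulr0.
rewrite (brZr hb) bw !linearZ /= coord_free ?(basis_free bb) // mulrA eq_sym.
by rewrite eq_sym.
Qed.

Lemma weight_neq0 la x : weight la x -> x != 0 ->
  exists2 i, w i = la & coord b i x != 0.
Proof.
move=> xla x0; case: (pickP (fun i => coord b i x != 0)) => [i xi|x0'].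
  by exists i => //; exact: weight_coord xi.
case/eqP: x0; rewrite (basis_coordE bb x) big1 // => i _.
by have /negbFE/eqP -> := x0' i; rewrite scale0r.
Qed.

Lemma weights_center (h : subvs_of t) : (forall i, w i h = 0) -> h = 0.
Proof.
move=> wh0; apply: val_inj; apply: (center0 hb hs) => y.
rewrite (br_anti hb) (basis_coordE bb y) (br_sumr hb) big1 ?oppr0 // => i _.
by rewrite (brZr hb) bw wh0 scale0r scaler0.
Qed.

(* The trace of [e, f] vanishes on the sum of the weight spaces in the
   la-string through w i. *)
Lemma weight_coroot (la : dual K t) : exists q : 'I_n -> K,
  (forall i, q i \is Num.real) /\
  forall e f (h : subvs_of t), weight la e -> weight (- la) f ->
    vsval h = br e f -> forall i, w i h = q i * la h.
Proof.
suff qP i : exists q : K, q \is Num.real /\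
    forall e f (h : subvs_of t), weight la e -> weight (- la) f ->
    vsval h = br e f -> w i h = q * la h.
  have [q qE] := choice qP; exists q; split=> [i|e f h we wf hE i].
    by case: (qE i).
  by have [_ /(_ e f h we wf hE)] := qE i.
pose P : pred 'I_n := fun j => `[< exists k : int, w j = w i + k%:~R *: la >].
have kP j : exists k : int, P j -> w j = w i + k%:~R *: la.
  case: (asboolP (exists k : int, w j = w i + k%:~R *: la)) => [[k ->]|nP].
    by exists k.
  by exists 0 => /asboolP.
have [k kE] := choice kP.
have Pi : P i by apply/asboolP; exists 0; rewrite scale0r addr0.
have P_gt0 : (#|P|%:R : K) != 0.
  by rewrite pnatr_eq0 -lt0n; apply/card_gt0P; exists i.
(* The vanishing trace is [#|P|] times [w i h] plus the sum of the [k j] times [la h], whence this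
   quotient. *)
exists (- (\sum_(j | P j) k j)%:~R / #|P|%:R); split.
  by rewrite rpredM ?rpredN ?realz // rpredV realn.
move=> e f h we wf hE.
have stab (z : int) x : weight (z%:~R *: la) x -> basis_stable b P (ad hb x).
  move=> wx j m /asboolP[c jE].
  rewrite adE => /(weight_coord (weight_br wx (bw j))) mE.
  by apply/asboolP; exists (z + c); rewrite mE jE intrD scalerDl addrCA.
have se : basis_stable b P (ad hb e) by apply: (stab 1); rewrite scale1r.
have sf : basis_stable b P (ad hb f) by apply: (stab (-1)); rewrite scaleN1r.
have : ptrace b P (ad hb (vsval h)) = 0.
  have -> : ad hb (vsval h) = (ad hb e \o ad hb f)%VF - (ad hb f \o ad hb e)%VF.
    apply/lfunP => x; rewrite add_lfunE opp_lfunE !comp_lfunE !adE.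
    by rewrite (br_jacobi hb e) -hE addrK.
  by rewrite ptraceB ptraceC ?subrr.
rewrite /ptrace (eq_bigr (fun j => w i h + (k j)%:~R * la h)) => [|j Pj];
  last first.
  rewrite adE bw linearZ /= coord_free ?(basis_free bb) // eqxx mulr1.
  by rewrite (kE j Pj) add_lfunE scale_lfunE.
rewrite big_split /= sumr_const -mulr_suml -rmorph_sum /=.
move/eqP; rewrite addr_eq0 => /eqP wE; apply: (mulIf P_gt0).
by rewrite mulr_natr wE mulrAC divfK // mulNr.
Qed.

(** All weights are multiples of [la] on [h], so they all vanish there and [h] is central. *)
Lemma coroot_eq0 la e f (h : subvs_of t) : weight la e -> weight (- la) f ->
  vsval h = br e f -> la h = 0 -> h = 0.
Proof.
move=> we wf hE h0; have [q [_ qE]] := weight_coroot la.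
by apply: weights_center => i; rewrite (qE _ _ _ we wf hE) h0 mulr0.
Qed.

(* The extension of la by zero on the nonzero weight spaces kills all brackets,
   so its kernel is an ideal. *)
Lemma dual_coroots_eq0 (la : dual K t) :
  (forall i e f (h : subvs_of t), weight (w i) e -> weight (- w i) f ->
     vsval h = br e f -> la h = 0) -> la = 0.
Proof.
move=> la0.
pose L (x : g) : K^o := \sum_(i | w i == 0) coord b i x *: la (vsproj t b`_i).
have Ll : linear L.
  move=> a x y; rewrite /L scaler_sumr -big_split; apply: eq_bigr => i _ /=.
  by rewrite linearP scalerDl scalerA.
pose LL : 'Hom(g, K^o) :=
  linfun (HB.pack L (GRing.isLinear.Build _ _ _ _ L Ll) : {linear g -> K^o}).
have LLE x : LL x = L x by rewrite lfunE.
have Lt (h : subvs_of t) : L (vsval h) = la h.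
  have wh : weight 0 (vsval h) by apply/weight0P; exact: (valP h).
  rewrite -[in RHS](vsvalK h) {2}(basis_coordE bb (vsval h)) !linear_sum /=.
  rewrite [in RHS](bigID (fun i => w i == 0)) /= [X in _ + X]big1 ?addr0.
    by apply: eq_bigr => i _; rewrite !linearZ.
  move=> i wi.
  have [->|/(weight_coord wh)/eqP] := eqVneq (coord b i (vsval h)) 0.
    by rewrite scale0r !linear0.
  by rewrite (negPf wi).
have Lbr x y : br x y \in lker LL.
  rewrite memv_ker LLE (basis_coordE bb x) (br_suml hb) -LLE linear_sum /=.
  rewrite big1 // => i _; rewrite (brZl hb) (basis_coordE bb y) (br_sumr hb).
  rewrite linearZ linear_sum /= big1 ?scaler0 // => j _.
  rewrite (brZr hb) linearZ /= LLE.
  have wij := weight_br (bw i) (bw j).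
  (* A bracket of nonzero weight has no component of weight zero; one of weight zero lies in [t],
     where the hypothesis on [la] applies. *)
  have [ij|ij] := eqVneq (w i + w j) 0; last first.
    rewrite /L big1 ?scaler0 // => k /eqP k0.
    have [->|/(weight_coord wij)] := eqVneq (coord b k (br b`_i b`_j)) 0.
      by rewrite scale0r.
    by move=> kij; rewrite -kij k0 eqxx in ij.
  rewrite ij in wij; have /weight0P ht' := wij.
  rewrite -(vsprojK ht') Lt (la0 i b`_i b`_j) ?scaler0 ?vsprojK //.
  by move/eqP: ij; rewrite addrC addr_eq0 => /eqP <-.
have kf := ideal_of_brackets hs Lbr.
apply/lfunP => h; rewrite zero_lfunE -Lt -LLE; apply/eqP.
by rewrite -memv_ker kf memvf.
Qed.

(** * The Killing form and one-dimensional weight spaces *)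

Definition killing x y := ptrace b predT (ad hb x \o ad hb y)%VF.

Lemma killingC x y : killing x y = killing y x.
Proof. exact: ptraceC. Qed.

Lemma ad_br x y :
  ad hb (br x y) = (ad hb x \o ad hb y)%VF - (ad hb y \o ad hb x)%VF.
Proof.
apply/lfunP => z; rewrite add_lfunE opp_lfunE !comp_lfunE !adE.
by rewrite (br_jacobi hb x) addrK.
Qed.

(** With X, Y, Z the adjoint maps, the traces of YXZ and XZY agree by cyclicity. *)
Lemma killing_invariant x y z : killing (br x y) z = killing x (br y z).
Proof.
rewrite /killing !ad_br comp_lfunDl comp_lfunDr comp_lfunNl comp_lfunNr.
rewrite !ptraceB.
rewrite -!comp_lfunA; congr (_ - _).
rewrite ptraceC // -!comp_lfunA //.
Qed.

Lemma ad_linear : linear (ad hb).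
Proof.
move=> a x y; apply/lfunP => z; rewrite add_lfunE scale_lfunE !adE.
by case: hb => ->.
Qed.

Lemma killing_linear y : linear (fun x => killing x y : K^o).
Proof.
move=> a x z; rewrite /killing ad_linear comp_lfunDl -comp_lfunZl /ptrace.
rewrite scaler_sumr -big_split; apply: eq_bigr => i _ /=.
by rewrite add_lfunE scale_lfunE linearP.
Qed.

Lemma killingZl a x y : killing (a *: x) y = a * killing x y.
Proof.
rewrite /killing /ptrace mulr_sumr; apply: eq_bigr => i _.
by rewrite !comp_lfunE !adE (brZl hb) linearZ.
Qed.

Lemma killingZr a x y : killing x (a *: y) = a * killing x y.
Proof. by rewrite killingC killingZl killingC. Qed.

(** The radical is an ideal by invariance. Were it everything, then for [h = [e, f]] with [e], [f]
    of opposite weights, the sum of the squares of the [w i h] would be 0; the [w i h] being real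
    multiples of one number, they all vanish. Then all weights are zero and [t] is everything,
    although it is abelian. *)
Lemma killing_nondegenerate x : (forall i : 'I_n, killing x b`_i = 0) -> x = 0.
Proof.
pose L y : 'Hom(g, K^o) := linfun (HB.pack (fun x => killing x y : K^o)
  (GRing.isLinear.Build _ _ _ _ _ (killing_linear y)) : {linear g -> K^o}).
have LE y z : L y z = killing z y by rewrite lfunE.
pose rad := (\bigcap_(i < n) lker (L b`_i))%VS.
have radP y : reflect (forall z, killing y z = 0) (y \in rad).
  apply: (iffP idP) => [|yr]; last first.
    by apply/subv_bigcapP => i _; rewrite -memvE memv_ker LE yr.
  rewrite memvE => yr z; rewrite killingC -LE (basis_coordE bb z) linear_sum /=.
  rewrite big1 // => i _; rewrite linearZ /= LE killingC -LE.
  move/subv_bigcapP: yr => /(_ i isT); rewrite -memvE memv_ker => /eqP ->.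
  by rewrite scaler0.
have [_ _ sI] := hs.
have xrad : (forall i : 'I_n, killing x b`_i = 0) -> x \in rad.
  move=> x0; rewrite memvE; apply/subv_bigcapP => i _.
  by rewrite -memvE memv_ker LE x0.
case: (sI rad) => [y z /radP zr|rad0 /xrad|radf _].
- by apply/radP => u; rewrite killingC -killing_invariant killingC zr.
- by rewrite rad0 memv0 => /eqP.
have k0 y z : killing y z = 0 by have /radP-> : y \in rad by rewrite radf memvf.
have w0 i : w i = 0.
  apply: dual_coroots_eq0 => j e f h we wf hE.
  have [q [qr qE]] := weight_coroot (w j).
  have := k0 (vsval h) (vsval h).
  rewrite /killing /ptrace (eq_bigr (fun i => w i h ^+ 2)) => [/eqP|m _];
    last first.
    rewrite comp_lfunE !adE bw (brZr hb) bw !linearZ /=.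
    by rewrite coord_free ?(basis_free bb) // eqxx mulr1 expr2.
  rewrite (eq_bigr (fun i => q i ^+ 2 * w j h ^+ 2)) => [|m _]; last first.
    by rewrite (qE _ _ _ we wf hE) exprMn.
  rewrite -mulr_suml mulf_eq0 sqrf_eq0 => /orP[q0|/eqP jh0]; last first.
    by rewrite (coroot_eq0 we wf hE jh0) linear0.
  have /eqP qi : q i == 0.
    rewrite -sqrf_eq0; move: q0; rewrite psumr_eq0 => [/allP/(_ i)|m _].
      by apply; rewrite mem_index_enum.
    by rewrite real_exprn_even_ge0.
  by rewrite (qE _ _ _ we wf hE) qi mul0r.
have tT y : y \in t.
  apply/weight0P => h; rewrite (basis_coordE bb y) (br_sumr hb) scaler_sumr.
  by apply: eq_bigr => i _; rewrite (brZr hb) bw w0 lfunE /= !scale0r scaler0.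
have [tab _ _] := ht; have [_ [y [z yz]] _] := hs.
by case: yz; apply: tab; exact: tT.
Qed.

(** Some basis vector pairs nontrivially with [x] under the Killing form; invariance forces its
    weight to be [- la], and then its bracket with [x] pairs nontrivially with any [h] such that
    [la h] is nonzero. *)
Lemma weight_opp_bracket la x : weight la x -> la != 0 -> x != 0 ->
  exists2 y, weight (- la) y & br x y != 0.
Proof.
move=> xla la0 x0.
case: (pickP (fun i : 'I_n => killing x b`_i != 0)) => [i xi|kx0]; last first.
  case/eqP: x0; apply: killing_nondegenerate => i.
  by have /= /negbFE/eqP := kx0 i.
have wi : w i = - la.
  apply/lfunP => h; rewrite opp_lfunE; apply: (mulIf xi).
  have := killing_invariant x (vsval h) b`_i; rewrite (br_anti hb) xla bw.
  by rewrite -scaleNr killingZl killingZr.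
exists b`_i; first by rewrite -wi.
have [h lah] : exists h, la h != 0.
  by have /lfunPn[h] := la0; rewrite zero_lfunE; exists h.
apply/eqP => xb0; have := killing_invariant x b`_i (vsval h).
rewrite xb0 (br_anti hb b`_i) bw wi opp_lfunE scaleNr opprK killingZr.
have := killingZl 0 0 (vsval h); rewrite scale0r mul0r => -> /esym/eqP.
by rewrite mulf_eq0 (negPf lah) (negPf xi).
Qed.

(* With [e, f] = h and la(h) != 0, subtract from x a multiple of e so that f
   kills it; since e kills it too, so does h. *)
Lemma weight_dim1 la e x : weight la e -> weight la x -> la != 0 -> e != 0 ->
  (forall y, weight (la + la) y -> y = 0) -> exists c, x = c *: e.
Proof.
move=> we wx la0 e0 no2; have [f wf ef0] := weight_opp_bracket we la0 e0.
have inT y : weight la y -> br y f \in t.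
  by move=> wy; apply/weight0P; rewrite -(subrr la); exact: weight_br.
have [q [_ qE]] := weight_coroot la.
pose h := vsproj t (br e f).
have hE : vsval h = br e f by rewrite vsprojK // inT.
pose k := vsproj t (br x f).
have kE : vsval k = br x f by rewrite vsprojK // inT.
have lah : la h != 0.
  apply: contraNneq ef0 => lah; rewrite -hE.
  by rewrite (coroot_eq0 we wf hE lah).
exists (la k / la h); apply/eqP; rewrite -subr_eq0; set y := x - _.
have wy : weight la y by apply: weightB => //; exact: weightZ.
have yf : br y f = 0.
  have -> : br y f = vsval (k - (la k / la h) *: h).
    by rewrite (brBl hb) (brZl hb) -kE -hE.
  rewrite (weights_center (h := k - _)) // => i.
  have -> : w i (k - (la k / la h) *: h) = w i k - (la k / la h) * w i h.
    by rewrite linearB linearZ.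
  by rewrite (qE _ _ _ we wf hE) (qE _ _ _ wx wf kE) mulrCA divfK // subrr.
have ey : br e y = 0 by apply: no2; exact: weight_br.
have := br_jacobi hb e y f; rewrite yf ey (brx0 hb) (br0x hb) add0r -hE.
rewrite (br_anti hb) wy => /esym/eqP;
by rewrite oppr_eq0 scaler_eq0 (negPf lah).
Qed.

(** The hypothesis says that [U] is spanned by the basis vectors whose weight satisfies [Q]. *)
Lemma dim_weight_sum (Q : pred (dual K t)) (U : {vspace g}) :
  (forall x, x \in U <-> forall i, coord b i x != 0 -> Q (w i)) ->
  \dim U = #|[pred i | Q (w i)]|.
Proof.
move=> UP; pose s := [seq b`_(i : 'I_n) | i <- enum [pred i | Q (w i)]].
have ub := free_uniq (basis_free bb).
have sb : map (fun i : 'I_n => b`_i) (enum 'I_n) = b.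
  rewrite -[RHS](mkseq_nth 0) size_tuple /mkseq.
  by rewrite -val_enum_ord -map_comp.
have fs : free s.
  pose p x := [exists i : 'I_n, (b`_i == x) && Q (w i)].
  suff -> : s = filter p b by rewrite filter_free ?(basis_free bb).
  rewrite -sb filter_map /s enumT; congr (map _ _); apply: eq_filter => i /=.
  apply/idP/existsP => [Qi|[j /andP[/eqP bji]]].
    by exists i; rewrite eqxx.
  suff -> : i = j by [].
  by apply/val_inj/eqP; rewrite -(nth_uniq 0 _ _ ub) ?size_tuple ?ltn_ord //;
    apply/eqP.
suff bs : basis_of U (in_tuple s) by rewrite (size_basis bs) /s size_map -cardE.
rewrite /basis_of fs andbT eqEsubv; apply/andP; split.
  apply/span_subvP => _ /mapP[i Qi ->]; apply/UP => j.
  rewrite coord_free ?(basis_free bb) // pnatr_eq0 eqb0 negbK => /eqP <-.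
  by rewrite mem_enum in Qi.
apply/subvP => x /UP xQ; rewrite (basis_coordE bb x) memv_suml // => i _.
have [->|/xQ Qi] := eqVneq (coord b i x) 0; first by rewrite scale0r mem0v.
by rewrite memvZ // memv_span //; apply/mapP; exists i; rewrite ?mem_enum.
Qed.

End Weights.

(** * The dimension of g(0) *)

Section RootSpaces.
Local Open Scope complex_scope.
Variables (R : realType) (g : vectType R[i]) (br : g -> g -> g).
Variable (t : {vspace g}).
Variables (E : vectType R) (ip : E -> E -> R) (Delta : {fset E}).
Variables (wt : E -> dual R[i] t) (Pi : {fset E}) (theta : E).
Hypotheses (hs : simple_lie_algebra br) (ht : cartan_subalgebra br t).
Hypothesis hD : root_system ip Delta.
Hypothesis hwt : roots_of_lie_algebra br Delta wt.
Hypothesis hPi : simple_roots Delta Pi.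

Let hb : lie_bracket br. Proof. by case: hs. Qed.

Lemma wt0 : wt 0 = 0.
Proof.
case: hwt => wtl _ _; have /eqP := wtl 1 0 0.
by rewrite scaler0 addr0 rmorph1 scale1r -subr_eq0 opprD addrA subrr add0r
  oppr_eq0 => /eqP.
Qed.

Lemma wt_sum I (r : seq I) (a : I -> R) (v : I -> E) :
  wt (\sum_(i <- r) a i *: v i) = \sum_(i <- r) (a i)%:C *: wt (v i).
Proof.
case: hwt => wtl _ _; elim: r => [|i r IHr]; first by rewrite !big_nil wt0.
by rewrite !big_cons wtl IHr.
Qed.

Lemma wt_eq0 v : wt v = 0 -> v = 0.
Proof. by case: hwt => _ wti _; rewrite -wt0 => /wti. Qed.

Variables (n : nat) (b : n.-tuple g) (w : 'I_n -> dual R[i] t).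
Hypotheses (bb : basis_of {:g} b).
Hypothesis bw : forall i, weight br (w i) b`_i.

Lemma basis_neq0 (i : 'I_n) : b`_i != 0.
Proof. by rewrite (basis_not0 bb) // mem_nth ?size_tuple. Qed.

Lemma root_is_weight u : u \in Delta -> wt u != 0 /\ exists i, w i = wt u.
Proof.
case: hwt => _ _ /(_ (wt u))[_ wD] uD; have [|u0 rs0] := wD; first by exists u.
split=> //; have xr := memv_pick (root_space br (wt u)).
have xw : weight br (wt u) (vpick (root_space br (wt u))).
  by apply/(root_spaceP _ _ hb).
have x0 : vpick (root_space br (wt u)) != 0 by rewrite vpick0.
by have [i wi _] := weight_neq0 hs bb bw xw x0; exists i.
Qed.

Lemma weight_is_root i : w i != 0 -> exists2 u, u \in Delta & wt u = w i.
Proof.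
case: hwt => _ _ wD wi; apply/wD; split=> //.
apply: contraNneq (basis_neq0 i) => r0; rewrite -memv0 -r0.
by apply/(root_spaceP _ _ hb); exact: bw.
Qed.

Lemma nat_combE v : nat_comb Pi v ->
  exists c : 'I_(size Pi) -> nat, v = \sum_i (c i)%:R *: (enum_fset Pi)`_i.
Proof.
case=> c ->; exists (fun i => c (enum_fset Pi)`_i).
rewrite (big_nth 0) big_mkord; apply: eq_bigr => i _.
by rewrite scaler_nat.
Qed.

(** Every nonzero weight is a root, hence a combination of simple roots, so [h] is central. *)
Lemma wt_simple_eq0 (h : subvs_of t) :
  (forall i : 'I_(size Pi), wt (enum_fset Pi)`_i h = 0) -> h = 0.
Proof.
have wt_comb (c : 'I_(size Pi) -> R) :
    (forall i : 'I_(size Pi), wt (enum_fset Pi)`_i h = 0) ->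
    wt (\sum_i c i *: (enum_fset Pi)`_i) h = 0.
  move=> h0; rewrite wt_sum sum_lfunE big1 // => j _.
  by rewrite scale_lfunE h0 scaler0.
move=> h0; apply: (weights_center hs bb bw) => i.
have [->|/weight_is_root[u uD <-]] := eqVneq (w i) 0; first by rewrite lfunE.
case: hPi => _ _ /(_ u uD)[|] /nat_combE[c].
  by move->; rewrite wt_comb.
move/eqP; rewrite eqr_oppLR => /eqP ->; rewrite -sumrN.
by under eq_bigr do rewrite -scaleNr; rewrite wt_comb.
Qed.

(* On [g_la, g_-la] the simple roots are real multiples of la, so that the real
   and imaginary parts of a linear relation are linear relations. *)
Lemma wt_simple_free (c : 'I_(size Pi) -> R[i]) :
  \sum_i c i *: wt (enum_fset Pi)`_i = 0 -> forall i, c i = 0.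
Proof.
move=> c0.
have PiD (i : 'I_(size Pi)) : (enum_fset Pi)`_i \in Delta.
  by case: hPi => /fsubsetP sPi _ _; apply: sPi; rewrite mem_nth.
(* [p] will be the real part, then the imaginary part. *)
have pc0 (p : R[i] -> R) : p 0 = 0 -> {morph p : x y / x + y} ->
    (forall x r, p (x * r%:C) = p x * r) -> forall i, p (c i) = 0.
  move=> p0 pD pM; suff : \sum_i p (c i) *: (enum_fset Pi)`_i = 0.
    by case: hPi => _ fPi _;
      have /freeP := fPi : free (in_tuple (enum_fset Pi)); apply.
  apply: wt_eq0; apply: (dual_coroots_eq0 hs ht bb bw) => i e f h we wf hE.
  have [q [qr qE]] := weight_coroot hs bb bw (w i).
  have rP (j : 'I_(size Pi)) :
      exists r : R, wt (enum_fset Pi)`_j h = r%:C * w i h.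
    have [_ [k kE]] := root_is_weight (PiD j); exists (complex.Re (q k)).
    by rewrite -kE (RRe_real (qr k)) (qE _ _ _ we wf hE).
  have [r rE] := choice rP.
  rewrite wt_sum sum_lfunE.
  under eq_bigr do rewrite scale_lfunE rE [_ *: _]mulrA -rmorphM.
  rewrite -mulr_suml -rmorph_sum.
  have [->|wih] := eqVneq (w i h) 0; first by rewrite mulr0.
  have : (\sum_j c j *: wt (enum_fset Pi)`_j) h = 0 by rewrite c0 zero_lfunE.
  rewrite sum_lfunE.
  under eq_bigr do rewrite scale_lfunE rE [_ *: _]mulrA.
  rewrite -mulr_suml => /eqP; rewrite mulf_eq0 (negPf wih) orbF => /eqP s0.
  rewrite (_ : \sum_j _ = 0) ?mul0r ?rmorph0 ?mul0r //.
  rewrite -[RHS]p0 -s0 (big_morph p pD p0).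
  by apply: eq_bigr => j _; rewrite pM.
move=> i; apply/eqP; rewrite eq_complex.
rewrite (pc0 (@complex.Re R)) ?(pc0 (@complex.Im R)) ?eqxx //.
- by case=> ? ? [].
- by case=> x1 x2 r /=; rewrite mulr0 add0r.
- by case=> ? ? [].
- by case=> x1 x2 r /=; rewrite mulr0 subr0.
Qed.

(** Evaluation at the simple roots is injective on [t], which bounds its dimension above; their
    freeness in the dual of [t] bounds it below. *)
Lemma dim_cartan : \dim t = #|` Pi|.
Proof.
apply/eqP; rewrite eqn_leq; apply/andP; split.
  pose F (h : subvs_of t) : 'rV[R[i]]_(size Pi) :=
    \row_i wt (enum_fset Pi)`_i h.
  have Fl : linear F by move=> a x y; apply/rowP=> i; rewrite !mxE linearP.
  pose FF := linfun (HB.pack F (GRing.isLinear.Build _ _ _ _ F Fl) :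
    {linear subvs_of t -> 'rV[R[i]]_(size Pi)}).
  have k0 : lker FF = 0%VS.
    apply/eqP; rewrite -subv0; apply/subvP => h;
      rewrite memv_ker memv0 lfunE /=.
    move=> /eqP/rowP Fh; apply/eqP/wt_simple_eq0 => i.
    by have := Fh i; rewrite !mxE.
  have dt : \dim (FF @: fullv) = \dim t.
    by rewrite limg_dim_eq ?k0 ?capv0 // dimvf.
  rewrite -dt; apply: leq_trans (dimvS (subvf _)) _.
  by rewrite dimvf /dim /= mul1n.
pose Y := [tuple wt (enum_fset Pi)`_i | i < size Pi].
have fY : free Y.
  apply/freeP => c c0; apply: wt_simple_free; rewrite -[RHS]c0.
  by apply: eq_bigr => i _; rewrite -tnth_nth tnth_mktuple.
move: (fY); rewrite /free size_tuple => /eqP <-.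
apply: leq_trans (dimvS (subvf _)) _.
by rewrite dimvf /dim /= muln1.
Qed.

(** Both sides count the basis vectors whose weight is zero or a root of degree 0. *)
Lemma dim_lie_degree0 :
  \dim (lie_degree0 ip br Delta wt theta) =
  (#|` Pi| + #|` graded_roots ip Delta theta 0|)%N.
Proof.
have [_ wti _] := hwt; have [_ _ _ Dmul] := hD.
set D0 := graded_roots _ _ _ _.
have D0D u : u \in D0 -> u \in Delta by rewrite !inE => /andP[].
have dimE (Q : pred (dual R[i] t)) (U : {vspace g}) :
    (forall x, x \in U <-> forall i, coord b i x != 0 -> Q (w i)) ->
    \dim U = (\sum_i Q (w i))%N.
  by move/(dim_weight_sum bb) => ->; rewrite -sum1_card big_mkcond;
    apply: eq_bigr => i _; rewrite inE; case: (Q _).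
have weightP la x : weight br la x <-> forall i, coord b i x != 0 -> w i = la.
  split=> [xla i|xc h]; first exact: (weight_coord hs bb bw xla).
  rewrite (basis_coordE bb x) (br_sumr hb) scaler_sumr; apply: eq_bigr => i _.
  have [->|/xc <-] := eqVneq (coord b i x) 0; first
    by rewrite scale0r (brx0 hb) scaler0.
  by rewrite (brZr hb) bw !scalerA mulrC.
have dim_t : \dim t = (\sum_i (w i == 0%R))%N.
  apply: (dimE (pred1 0)) => x; rewrite -(weight0P ht) weightP /=.
  by split=> xc i /xc; [move=> -> | move/eqP].
have dim1 u : u \in Delta -> (\sum_i (w i == wt u) = 1)%N.
  move=> uD; have [u0 [i wi]] := root_is_weight uD.
  have bi : weight br (wt u) b`_i by rewrite -wi; exact: bw.
  rewrite -(dimE (pred1 (wt u)) <[b`_i]>%VS) => [|x]; first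
    by rewrite dim_vline basis_neq0.
  rewrite -[X in _ <-> X](_ : weight br (wt u) x <-> _); last first.
    by rewrite weightP; split=> xc j /xc; [move=> -> /= | move/eqP].
  split=> [/vlineP[k ->]|wx]; first exact: weightZ.
  apply/vlineP.
  apply: (weight_dim1 hs ht bb bw bi wx u0 (basis_neq0 i)) => y wy.
  apply/eqP/negPn/negP => y0; have [j wj _] := weight_neq0 hs bb bw wy y0.
  (* A vector of weight [2 u] would make [2 u] a root, but the only multiples of [u] that are roots
     are [u] and [- u]. *)
  have uu0 : wt u + wt u != 0.
    by rewrite -mulr2n -scaler_nat scaler_eq0 pnatr_eq0.
  have [wtl _ _] := hwt; have [|v vD] := @weight_is_root j; first by rewrite wj.
  rewrite wj.
  have <- : wt (1 *: u + u) = wt u + wt u by rewrite wtl rmorph1 scale1r.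
  move=> /wti vE.
  have : (2 : R) *: u \in Delta by rewrite scaler_nat mulr2n -{1}[u]scale1r -vE.
  by case/(Dmul _ _ uD) => /eqP; rewrite -subr_eq0; apply/negP;
    rewrite lt0r_neq0 //; lra.
rewrite -dim_cartan dim_t.
have -> : #|` D0| = (\sum_(u <- D0) \sum_i (w i == wt u))%N.
  by rewrite card_fset_sum1; apply: eq_big_seq => u /D0D/dim1.
rewrite exchange_big -big_split /=.
(* Roots are nonzero weights and [wt] is injective, so each basis vector is counted at most once. *)
have wDE i : ((w i == 0%R) + \sum_(u <- D0) (w i == wt u))%N =
    (w i == 0) || has (fun u => w i == wt u) D0.
  have [wi0|wi0] /= := eqVneq (w i) 0.
    rewrite big_seq big1 // => u /D0D uD; rewrite wi0.
    by have [/negPf u0 _] := root_is_weight uD; rewrite eq_sym u0.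
  rewrite add0n; case: hasP => [[u uD /eqP wiu]|nD].
    rewrite (big_fsetD1 u) //= wiu eqxx big_seq big1 ?addn0 // => v.
    rewrite !inE => /andP[vu _]; rewrite eq_sym.
    by apply/eqP; rewrite eqb0; apply: contraNneq vu => /wti ->.
  rewrite big_seq big1 // => u uD; apply/eqP; rewrite eqb0;
    apply/negP => /eqP wu.
  by case: nD; exists u => //; apply/eqP.
under eq_bigr do rewrite wDE.
apply: (dimE (fun la => (la == 0) || has (fun u => la == wt u) D0)) => x.
split=> [/memv_addP[y yt [z zs ->]] i|xc].
  rewrite linearD /= => xi.
  have [yi|yi] := eqVneq (coord b i y) 0; last first.
    by rewrite (weight_coord hs bb bw (iffRL (weight0P ht y) yt) yi) eqxx.
  move: xi; rewrite yi add0r => zi; apply/orP; right.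
  elim: (enum_fset D0) z zs zi => [|u s IHs] z.
    by rewrite big_nil memv0 => /eqP ->; rewrite linear0 eqxx.
  rewrite big_cons => /memv_addP[z1 z1u [z2 z2s ->]]; rewrite linearD /= => zi.
  have [z1i|z1i] := eqVneq (coord b i z1) 0.
    by rewrite /= (IHs _ z2s) ?orbT //; rewrite z1i add0r in zi.
  by rewrite /= (weight_coord hs bb bw (iffLR (root_spaceP _ _ hb) z1u) z1i)
    eqxx.
rewrite (basis_coordE bb x) memv_suml // => i _.
have [->|/xc] := eqVneq (coord b i x) 0; first by rewrite scale0r mem0v.
move=> wi; apply: memvZ; rewrite /lie_degree0 -/D0; case/orP: wi => [/eqP wi|].
  apply: subvP (addvSl _ _) _ _; apply/(weight0P ht); rewrite -wi; exact: bw.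
case/hasP => u uD /eqP wi; apply: subvP (addvSr _ _) _ _.
rewrite (big_fsetD1 u) //=; apply: subvP (addvSl _ _) _ _.
by apply/(root_spaceP _ _ hb); rewrite -wi; exact: bw.
Qed.

End RootSpaces.

(** * Incomparable pairs of roots *)

Section SimplyLaced.
Variables (R : realType) (E : vectType R) (ip : E -> E -> R).
Variables (Delta Pi : {fset E}) (theta : E).
Hypotheses (hip : inner_product ip) (hD : root_system ip Delta).
Hypotheses (hPi : simple_roots Delta Pi) (hth : highest_root Delta Pi theta).
Hypothesis hADE : simply_laced ip Delta.

(* Normalized so that roots have norm 2, hence that both arguments of a pairing
   of roots play the role of the coroot. *)
Definition form (u v : E) : R := 2 * ip u v / ip theta theta.

Lemma theta_root : theta \in Delta. Proof. by case: hth. Qed.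
Hint Resolve theta_root : core.

Lemma root_neq0 u : u \in Delta -> u != 0.
Proof. by case: hD => -[_ n0] _ _ _ uD; apply: contraNneq n0 => <-. Qed.

Lemma theta_norm_gt0 : 0 < ip theta theta.
Proof. by case: hip => _ _; apply; rewrite root_neq0. Qed.

Lemma formC u v : form u v = form v u.
Proof. by case: hip => _ ipC _; rewrite /form ipC. Qed.

Lemma form_linear v : scalar (form^~ v).
Proof.
case: hip => ipl _ _ a u w; rewrite /form ipl /=; field.
by rewrite gt_eqF // theta_norm_gt0.
Qed.

Lemma formZl a u v : form (a *: u) v = a * form u v.
Proof.
have h0 : form 0 v = 0 by have := form_linear v (-1) 0 0; rewrite scaler0 addr0;
  lra.
by have := form_linear v a u 0; rewrite /= addr0 h0 addr0.
Qed.
Lemma formDl u w v : form (u + w) v = form u v + form w v.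
Proof. by have := form_linear v 1 u w; rewrite /= scale1r mul1r. Qed.
Lemma formNl u v : form (- u) v = - form u v.
Proof. by rewrite -scaleN1r formZl mulN1r. Qed.
Lemma formZr a u v : form u (a *: v) = a * form u v.
Proof. by rewrite formC formZl formC. Qed.
Lemma formDr u w v : form u (w + v) = form u w + form u v.
Proof. by rewrite formC formDl ![form _ u]formC. Qed.
Lemma formNr u v : form u (- v) = - form u v.
Proof. by rewrite formC formNl formC. Qed.
Definition formE := (formDl, formDr, formNl, formNr, formZl, formZr).

Lemma form0l v : form 0 v = 0.
Proof. by rewrite -(scale0r 0) formZl mul0r. Qed.

Lemma form_suml I (r : seq I) P (F : I -> E) v :
  form (\sum_(i <- r | P i) F i) v = \sum_(i <- r | P i) form (F i) v.
Proof.
apply: (big_morph (form^~ v)) => [u w|]; [exact: formDl | exact: form0l].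
Qed.

Lemma form_gt0 u : u != 0 -> 0 < form u u.
Proof.
case: hip => _ _ ippos /ippos u0.
by rewrite /form divr_gt0 ?mulr_gt0 ?theta_norm_gt0.
Qed.

Lemma form_root u : u \in Delta -> form u u = 2.
Proof.
move=> uD; rewrite /form (hADE uD theta_root) mulfK //.
by rewrite gt_eqF // theta_norm_gt0.
Qed.

Lemma form_coroot u v : v \in Delta -> ip u (coroot ip v) = form u v.
Proof.
case: hip => ipl ipC _ vD; rewrite /coroot /form (hADE vD theta_root).
have ip0 : ip 0 u = 0 by have := ipl (-1) 0 0 u; rewrite scaler0 addr0; lra.
by rewrite ipC -[_ *: _]addr0 ipl ip0 addr0 [ip v u]ipC mulrAC.
Qed.

(** * Reflections and pairings of roots *)

Definition refl (c v : E) : E := v - form v c *: c.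

Lemma refl_root u v : u \in Delta -> v \in Delta -> refl u v \in Delta.
Proof.
by case: hD => _ reflD _ _ uD vD; have := reflD u v uD vD;
  rewrite /reflection form_coroot.
Qed.

Lemma form_int u v : u \in Delta -> v \in Delta ->
  exists m : int, form u v = m%:~R.
Proof.
case: hD => _ _ intD _ uD vD; have := intD v u vD uD; rewrite form_coroot //.
by move/intrP.
Qed.

Lemma refl_form c u : c \in Delta -> form (refl c u) c = - form u c.
Proof. by move=> cD; rewrite /refl !formE (form_root cD); ring. Qed.

Lemma reflK c : c \in Delta -> involutive (refl c).
Proof.
by move=> cD v; rewrite {1}/refl refl_form // /refl scaleNr opprK subrK.
Qed.

Lemma reflD c u v : refl c (u + v) = refl c u + refl c v.
Proof. by rewrite /refl formDl scalerDl opprD addrACA. Qed.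
Lemma reflN c u : refl c (- u) = - refl c u.
Proof. by rewrite /refl formNl scaleNr opprB opprK addrC. Qed.
Lemma reflB c u v : refl c (u - v) = refl c u - refl c v.
Proof. by rewrite reflD reflN. Qed.
Lemma refl_self c : c \in Delta -> refl c c = - c.
Proof.
by move=> cD; rewrite /refl form_root // scaler_nat mulr2n opprD addNKr.
Qed.

Lemma rootN u : u \in Delta -> - u \in Delta.
Proof. by move=> uD; rewrite -refl_self // refl_root. Qed.

(** The norm of [u - v] is 4 minus twice the pairing and is positive, so the integer [form u v] is
    less than 2. *)
Lemma form_le1 u v : u \in Delta -> v \in Delta -> u != v -> form u v <= 1.
Proof.
move=> uD vD; rewrite -subr_eq0 => /form_gt0.
rewrite !formE !form_root // [form v u]formC; have [m ->] := form_int uD vD.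
move=> m2; have : m%:~R < 2%:~R :> R by lra.
rewrite ltr_int -[X in _ <= X]/(1%:~R) ler_int; lia.
Qed.

Lemma form_eq2 u v : u \in Delta -> v \in Delta -> form u v = 2 -> u = v.
Proof.
move=> uD vD uv; apply/eqP/negPn/negP => /(form_le1 uD vD); lra.
Qed.

Variant unit_pairing (x : R) : Prop :=
  | PairingN1 of x = -1 | Pairing0 of x = 0 | Pairing1 of x = 1.

Lemma root_pairing u v : u \in Delta -> v \in Delta -> u != v -> u != - v ->
  unit_pairing (form u v).
Proof.
move=> uD vD uv uNv; have h1 := form_le1 uD vD uv.
have h2 := form_le1 uD (rootN vD) uNv; rewrite formNr in h2.
have [m mE] := form_int uD vD; rewrite mE in h1 h2 *.
have : (m <= 1) by rewrite -(ler_int R).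
have : (-1 <= m) by rewrite -(ler_int R); lra.
move=> h3 h4; have [->|[->|->]] : m = -1 \/ m = 0 \/ m = 1 by lia.
- by constructor 1.
- by constructor 2.
- by constructor 3.
Qed.

Lemma root_sub u v : u \in Delta -> v \in Delta -> form u v = 1 ->
  u - v \in Delta.
Proof.
by move=> uD vD uv; have := refl_root vD uD; rewrite /refl uv scale1r.
Qed.

Lemma root_add u v : u \in Delta -> v \in Delta -> form u v = -1 ->
  u + v \in Delta.
Proof.
by move=> uD vD uv; have := refl_root vD uD; rewrite /refl uv scaleN1r opprK.
Qed.

Lemma gradedP (j : int) u :
  reflect (u \in Delta /\ form u theta = j%:~R)
    (u \in graded_roots ip Delta theta j).
Proof.
rewrite !inE /= form_coroot //; apply: (iffP andP) => -[uD].
  by move/eqP.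
by move->.
Qed.

(* The coefficient of a in v, in terms of Pi; it is 0 if a is not in Pi. *)
Definition cf (a v : E) : R :=
  \sum_(i < size Pi | (enum_fset Pi)`_i == a)
    coord (in_tuple (enum_fset Pi)) i v.

Lemma cf_linear a : scalar (cf a).
Proof.
move=> k u v; rewrite /cf mulr_sumr -big_split; apply: eq_bigr => i _ /=.
by rewrite linearP.
Qed.

Lemma cfZ a k v : cf a (k *: v) = k * cf a v.
Proof. by rewrite /cf mulr_sumr; apply: eq_bigr => i _; rewrite linearZ. Qed.
Lemma cfD a u v : cf a (u + v) = cf a u + cf a v.
Proof. by rewrite -[u]scale1r cf_linear mul1r scale1r. Qed.
Lemma cfN a v : cf a (- v) = - cf a v.
Proof. by rewrite -scaleN1r cfZ mulN1r. Qed.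
Definition cfE := (cfD, cfN, cfZ).

Lemma cf_sum I (r : seq I) P (F : I -> E) a :
  cf a (\sum_(i <- r | P i) F i) = \sum_(i <- r | P i) cf a (F i).
Proof.
apply: (big_morph (cf a)) => [u w|]; first exact: cfD.
by rewrite -(scale0r 0) cfZ mul0r.
Qed.

Let fPi : free (in_tuple (enum_fset Pi)). Proof. by case: hPi. Qed.

Lemma cf_nth (j : 'I_(size Pi)) v :
  cf (enum_fset Pi)`_j v = coord (in_tuple (enum_fset Pi)) j v.
Proof.
rewrite /cf (bigD1 j) //= big1 ?addr0 // => i /andP[/eqP ij].
have /eqP := ij; rewrite nth_uniq ?fset_uniq // => /eqP/val_inj ->.
by rewrite eqxx.
Qed.

Lemma cf_simple a c : a \in Pi -> c \in Pi -> cf a c = (a == c)%:R.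
Proof.
move=> /(nthP 0)[k sk <-] /(nthP 0)[l sl <-].
rewrite -[k]/(val (Ordinal sk)) -[l]/(val (Ordinal sl)) cf_nth coord_free //.
by rewrite nth_uniq ?fset_uniq // eq_sym.
Qed.

Lemma simple_root a : a \in Pi -> a \in Delta.
Proof. by case: hPi => /fsubsetP sPi _ _; exact: sPi. Qed.
Hint Resolve simple_root : core.

(** * Expansion in simple roots, and the resulting order *)

Lemma cf_expand v : v = \sum_(a <- Pi) cf a v *: a.
Proof.
have vPi : v \in <<enum_fset Pi>>%VS.
  have : v \in <<enum_fset Delta>>%VS by case: hD => -[-> _] _ _ _;
    exact: memvf.
  apply: subvP; apply/span_subvP => u uD.
  have nc w : nat_comb Pi w -> w \in <<enum_fset Pi>>%VS.
    case=> c ->; rewrite big_seq; apply: memv_suml => a aP.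
    by rewrite -scaler_nat memvZ // memv_span.
  case: hPi => _ _ /(_ u uD)[/nc //|/nc]; by rewrite memvN.
rewrite {1}(coord_span (X := in_tuple (enum_fset Pi)) vPi).
rewrite (big_nth 0) big_mkord; apply: eq_bigr => i _.
by rewrite cf_nth.
Qed.

Lemma form_cf v u : form v u = \sum_(a <- Pi) cf a v * form a u.
Proof.
by rewrite {1}[v]cf_expand form_suml; apply: eq_bigr => a _; rewrite formZl.
Qed.

(** [pos (v - u)] encodes the order on roots with real coefficients; integrality is carried
    separately by [integral]. *)
Definition pos v := all (fun a => 0 <= cf a v) Pi.

Lemma posP v : reflect (forall a, a \in Pi -> 0 <= cf a v) (pos v).
Proof. exact: allP. Qed.

Lemma posD u v : pos u -> pos v -> pos (u + v).
Proof.
by move=> /posP up /posP vp; apply/posP => a aP; rewrite cfD addr_ge0 ?up ?vp.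
Qed.

Lemma nat_comb_cf v : nat_comb Pi v ->
  forall a, a \in Pi -> exists k : nat, cf a v = k%:R.
Proof.
case=> c -> a aP; exists (c a); rewrite cf_sum.
rewrite (big_fsetD1 a) //= -scaler_nat cfZ cf_simple // eqxx mulr1.
rewrite big_seq big1 ?addr0 // => d; rewrite !inE => /andP[da dP].
by rewrite -scaler_nat cfZ cf_simple // eq_sym (negPf da) mulr0.
Qed.

Lemma nat_comb_pos v : nat_comb Pi v -> pos v.
Proof. by move=> vn; apply/posP => a aP; have [k ->] := nat_comb_cf vn aP. Qed.

Definition integral v := forall a, a \in Pi -> exists m : int, cf a v = m%:~R.

Lemma integralN v : integral v -> integral (- v).
Proof. by move=> vi a /vi[m mE]; exists (- m); rewrite cfN mE mulrNz. Qed.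
Lemma integralD u v : integral u -> integral v -> integral (u + v).
Proof.
move=> ui vi a aP; have [[m mE] [k kE]] := (ui a aP, vi a aP).
by exists (m + k); rewrite cfD mE kE intrD.
Qed.

Lemma root_integral u : u \in Delta -> integral u.
Proof.
have ni v : nat_comb Pi v -> integral v.
  by move=> vn a aP; have [k ->] := nat_comb_cf vn aP; exists k.
case: hPi => _ _ sg /sg[/ni //|/ni /integralN]; by rewrite opprK.
Qed.

Lemma root_pos u : u \in Delta -> pos u \/ pos (- u).
Proof. by case: hPi => _ _ sg /sg[]/nat_comb_pos; [left | right]. Qed.

Lemma cf_ge1 v a : integral v -> a \in Pi -> 0 < cf a v -> 1 <= cf a v.
Proof.
move=> vi /vi[m ->]; rewrite ltr0z -[X in X <= _]/(1%:~R) ler_int; lia.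
Qed.

Lemma pos_anti v : pos v -> pos (- v) -> v = 0.
Proof.
move=> /posP vp /posP vn; rewrite [v]cf_expand big_seq big1 // => a aP.
have := vn a aP; rewrite cfN oppr_ge0 => v0; have := vp a aP.
by rewrite le0r ltNge v0 orbF => /eqP ->; rewrite scale0r.
Qed.

Lemma theta_max u : u \in Delta -> pos (theta - u).
Proof. by case: hth => _ /[apply]; exact: nat_comb_pos. Qed.

Lemma theta_cf a : a \in Pi -> 1 <= cf a theta.
Proof.
move=> aP; have /posP/(_ a aP) := theta_max (simple_root aP).
by rewrite !cfE (cf_simple aP aP) eqxx subr_ge0.
Qed.

(** The reflection of [theta] in [a] is a root, hence lies below [theta]. *)
Lemma theta_dominant a : a \in Pi -> 0 <= form a theta.
Proof.
move=> aP; have aD := simple_root aP.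
have /posP/(_ a aP) := theta_max (refl_root aD theta_root).
by rewrite /refl opprB addrC subrK cfZ cf_simple // eqxx mulr1 formC.
Qed.

(** Were the pairing 1, [a - c] would be a root with coefficients of both signs. *)
Lemma simple_form a c : a \in Pi -> c \in Pi -> a != c -> form a c <= 0.
Proof.
move=> aP cP ac; have [aD cD] := (simple_root aP, simple_root cP).
have aNc : a != - c.
  apply/eqP => aE; have : cf c a = 0 by rewrite cf_simple // eq_sym (negPf ac).
  by rewrite aE cfN cf_simple // eqxx /=; lra.
have [||ac1] := root_pairing aD cD ac aNc; try lra.
have [/posP/(_ c cP)|/posP/(_ a aP)] := root_pos (root_sub aD cD ac1).
  by rewrite !cfE !cf_simple // eqxx eq_sym (negPf ac) /=; lra.
by rewrite !cfE !cf_simple // eqxx (negPf ac) /=; lra.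
Qed.

Lemma form_le_cf v c : c \in Pi ->
  (forall a, a \in Pi -> a != c -> 0 <= cf a v) ->
  form v c <= 2 * cf c v.
Proof.
move=> cP v0; rewrite form_cf (big_fsetD1 c) //=
  form_root ?simple_root // mulrC.
rewrite gerDl big_seq sumr_le0 // => a; rewrite !inE => /andP[ac aP].
by rewrite mulr_ge0_le0 ?v0 // simple_form.
Qed.

Lemma form_eq_cf v c : c \in Pi ->
  (forall a, a \in Pi -> a != c -> cf a v = 0) ->
  v = cf c v *: c.
Proof.
move=> cP v0; rewrite {1}[v]cf_expand (big_fsetD1 c) //= big_seq big1 ?addr0 //.
by move=> a; rewrite !inE => /andP[ac aP]; rewrite v0 // scale0r.
Qed.

Lemma refl_cf c v a : a \in Pi -> c \in Pi -> a != c ->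
  cf a (refl c v) = cf a v.
Proof.
by move=> aP cP ac; rewrite /refl !cfE (cf_simple aP cP) (negPf ac) mulr0 subr0.
Qed.

(** A positive root other than [c] has a positive coefficient at another simple root, which the
    reflection does not change. *)
Lemma refl_pos c u : c \in Pi -> u \in Delta -> pos u -> u != c ->
  pos (refl c u).
Proof.
move=> cP uD /posP up uc; have cD := simple_root cP.
case: (boolP (all (fun a => (a == c) || (cf a u == 0)) Pi)) => [/allP u0|].
  have uE : u = cf c u *: c.
    by apply: form_eq_cf => // a aP ac; have := u0 a aP;
      rewrite /= (negPf ac) => /eqP.
  have [_ _ _ mulD] := hD; have := uD; rewrite uE => /(mulD _ _ cD)[c1|c1].
    by rewrite uE c1 scale1r eqxx in uc.
  by have := up c cP; rewrite c1; lra.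
case/allPn => a aP; rewrite negb_or => /andP[ac a0].
have [//|/posP/(_ a aP)] := root_pos (refl_root cD uD).
rewrite cfN refl_cf // => h; have := up a aP; rewrite le0r (negPf a0) /=; lra.
Qed.

(** Stated for integral vectors because [d] will be a difference of two roots, not itself a root.
    Only the coefficient at [c] can change sign; [form_le_cf] and the bound on the pairing prevent
    it. *)
Lemma refl_npos c d : c \in Pi -> integral d -> unit_pairing (form d c) ->
  ~~ pos d -> ~~ pos (refl c d).
Proof.
move=> cP di dc; apply: contra => /posP dp; have cD := simple_root cP.
have dp' a : a \in Pi -> a != c -> 0 <= cf a d.
  by move=> aP ac; rewrite -(refl_cf d aP cP ac) dp.
apply/posP => a aP; have [->|/dp' -> //] := eqVneq a c.
have := dp c cP; rewrite /refl !cfE (cf_simple cP cP) eqxx mulr1.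
have := form_le_cf cP dp'; case: dc => ->; try lra.
(* For pairing -1 the coefficient is at least -1/2, hence nonnegative by integrality. *)
have [m ->] := di c cP => h1 h2.
have : -1 <= m by rewrite -(ler_int R); lra.
rewrite le_eqVlt => /orP[/eqP mE|]; first by rewrite -mE in h1; lra.
by move=> m0; rewrite ler0z; lia.
Qed.

(** * Incomparability under simple reflections *)

Definition incomp u v := ~~ pos (u - v) && ~~ pos (v - u).

Lemma incompC u v : incomp u v = incomp v u.
Proof. by rewrite /incomp andbC. Qed.

Lemma pos0 : pos 0.
Proof. by apply/posP => a _; rewrite -(scale0r 0) cfZ mul0r. Qed.

Lemma incomp_neq u v : incomp u v -> u != v.
Proof.
by case/andP => uv _; apply: contraNneq uv => ->; rewrite subrr pos0.
Qed.

Lemma comparable_root u v : u - v \in Delta -> ~~ incomp u v.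
Proof.
rewrite /incomp negb_and !negbK => /root_pos[->//|].
by rewrite opprB => ->; rewrite orbT.
Qed.

Lemma refl_incomp c u v : c \in Pi -> u \in Delta -> v \in Delta ->
  unit_pairing (form (u - v) c) -> incomp u v -> incomp (refl c u) (refl c v).
Proof.
move=> cP uD vD uvc /andP[uv vu].
have di x y : x \in Delta -> y \in Delta -> integral (x - y).
  by move=> xD yD; apply: integralD; [|apply: integralN]; exact: root_integral.
rewrite /incomp -!reflB !refl_npos //; try exact: di.
rewrite -opprB formNl; case: uvc => ->.
- by constructor 3; rewrite opprK.
- by constructor 2; rewrite oppr0.
- by constructor 1.
Qed.

(** * Roots of degree one *)

Definition degree1 u := (u \in Delta) && (form u theta == 1).

Lemma degree1P u : degree1 u -> u \in Delta /\ form u theta = 1.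
Proof. by case/andP => uD /eqP. Qed.

Lemma degree1_pairing u v : degree1 u -> v \in Delta -> form v theta = 0 ->
  unit_pairing (form u v).
Proof.
move=> /degree1P[uD u1] vD v0; apply: root_pairing => //.
  by apply/eqP => uv; move: u1; rewrite uv; lra.
by apply/eqP => uv; move: u1; rewrite uv formNl; lra.
Qed.

Lemma degree1_pairing1 u v : degree1 u -> degree1 v -> u != v ->
  unit_pairing (form u v).
Proof.
move=> /degree1P[uD u1] /degree1P[vD v1] uv; apply: root_pairing => //.
by apply/eqP => uNv; move: u1; rewrite uNv formNl; lra.
Qed.

Lemma refl_degree1 c u : c \in Delta -> form c theta = 0 -> degree1 u ->
  degree1 (refl c u).
Proof.
move=> cD c0 /degree1P[uD u1]; apply/andP; split; first exact: refl_root.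
by rewrite /refl !formE c0 u1; apply/eqP; lra.
Qed.

Section Degree0.
Variable mu : E.
Hypotheses (muD : mu \in Delta) (mu0 : form mu theta = 0).

Definition dual1 u := theta + mu - u.

Lemma dual1K : involutive dual1.
Proof. by move=> u; rewrite /dual1 opprB addrC subrK. Qed.

Lemma dual1B u v : dual1 u - dual1 v = v - u.
Proof. by rewrite /dual1 opprB addrC addrA subrK. Qed.

(** Expanding the norm 2 of [theta + mu - u] gives [4 - 2 * form u mu = 2]. *)
Lemma dual1_pairing u : degree1 u -> degree1 (dual1 u) ->
  form u (dual1 u) = 0 /\ form u mu = 1.
Proof.
move=> /degree1P[uD u1] /degree1P[vD v1].
have := form_root vD; move: v1.
rewrite /dual1 !formE (form_root uD) (form_root muD).
rewrite (form_root theta_root) [form theta u]formC [form theta mu]formC.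
rewrite [form mu u]formC u1 mu0.
split; lra.
Qed.

(** [theta - u] is a root with pairing -1 with [mu], so adding [mu] gives a root. *)
Lemma dual1_degree1 u : degree1 u -> form u mu = 1 ->
  degree1 (dual1 u) /\ form (dual1 u) mu = 1.
Proof.
move=> /degree1P[uD u1] umu; split; last first.
  by rewrite /dual1 !formE (form_root muD) [form theta mu]formC mu0 umu; lra.
apply/andP; split; last first.
  by rewrite /dual1 !formE (form_root theta_root) mu0 u1; apply/eqP; lra.
have tuD : theta - u \in Delta by rewrite root_sub // formC.
rewrite /dual1 addrAC root_add // !formE umu [form theta mu]formC mu0; lra.
Qed.

(** The pairings of [u] with [v] and with [dual1 v] add up to 2 and are at most 1, so both are 1 and
    [u - v] is a root. *)
Lemma dual1_comparable u v : degree1 u -> form u mu = 1 -> degree1 v ->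
  form v mu = 1 -> u != v -> u != dual1 v -> ~~ incomp u v.
Proof.
move=> u1 umu v1 vmu uv uNv; have [w1 _] := dual1_degree1 v1 vmu.
have [uD uth] := degree1P u1; have [vD vth] := degree1P v1;
  have [wD _] := degree1P w1.
have := form_le1 uD vD uv; have := form_le1 uD wD uNv.
rewrite /dual1 !formE uth umu => h1 h2.
apply: comparable_root; apply: root_sub => //; lra.
Qed.

(** Let [v < u]. Then [v] is comparable with [dual1 u]: if [v] is above, [dual1 u < v < u]; if
    below, then [u] is below [dual1 v] by duality and [v < u < dual1 v]. Each contradicts an
    incomparability. *)
Lemma dual1_incomp_unique u v : degree1 u -> form u mu = 1 -> degree1 v ->
  form v mu = 1 -> incomp u (dual1 u) -> incomp v (dual1 v) ->
  u = v \/ u = dual1 v.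
Proof.
move=> u1 umu v1 vmu iu iv; have [->|uv] := eqVneq u v; first by left.
have [->|uNv] := eqVneq u (dual1 v); first by right.
exfalso; wlog uv_pos : u v u1 umu v1 vmu iu iv uv uNv / pos (u - v).
  move=> wl; have := dual1_comparable u1 umu v1 vmu uv uNv.
  rewrite negb_and !negbK => /orP[|]; first exact: (wl u v).
  apply: (wl v u) => //; first by rewrite eq_sym.
  by apply: contraNneq uNv => ->; rewrite dual1K.
have [w1 wmu] := dual1_degree1 u1 umu.
have vw : v != dual1 u by apply: contraNneq uNv => ->; rewrite dual1K.
have vw' : v != dual1 (dual1 u) by rewrite dual1K eq_sym.
have := dual1_comparable v1 vmu w1 wmu vw vw'.
have [/andP[/negP nu _] /andP[_ /negP nv]] := (iu, iv).
rewrite negb_and !negbK => /orP[h|h].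
  by apply: nu; have := posD uv_pos h; rewrite addrA subrK.
apply: nv; have -> : dual1 v - v = (dual1 v - u) + (u - v)
  by rewrite addrA subrK.
by apply: posD => //; rewrite -(dual1K u) dual1B.
Qed.

(* Roots of degree 0 orthogonal to all roots of degree 1 are orthogonal to all
   other roots, which contradicts the full support of theta. *)
Lemma degree1_nonorthogonal : exists2 u, degree1 u & form u mu != 0.
Proof.
apply: contrapT => noU.
pose Z c := [/\ c \in Delta, form c theta = 0 &
  forall u, degree1 u -> form u c = 0].
have Zmu : Z mu.
  split=> // u u1; apply/eqP/negPn/negP => umu; by case: noU; exists u.
have ZorthN c d : Z c -> d \in Delta -> ~ Z d -> form d c = 0.
  move=> [cD c0 cU] dD nZ.
  have [d1|d1] := boolP (degree1 d); first exact: cU.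
  have [d1'|d1'] := boolP (degree1 (- d)).
    by have := cU _ d1'; rewrite formNl; lra.
  have [->|dth] := eqVneq d theta; first by rewrite formC.
  have [->|dNth] := eqVneq d (- theta); first by rewrite formNl formC c0 oppr0.
  have d0 : form d theta = 0.
    have [h|//|h] := root_pairing dD theta_root dth dNth.
      by case/negP: d1'; rewrite /degree1 rootN // formNl h opprK eqxx.
    by case/negP: d1; rewrite /degree1 dD h eqxx.
  (* Reflecting [u] in [d] stays in degree 1, so [c] is orthogonal to both [u] and its reflection,
     hence to [d]. *)
  have [u [u1 ud]] : exists u, degree1 u /\ form u d != 0.
    apply: contrapT => nu; apply: nZ; split=> // u u1.
    by apply/eqP/negPn/negP => ud; apply: nu; exists u.
  have := cU _ (refl_degree1 dD d0 u1); rewrite /refl !formE (cU _ u1).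
  by move/eqP; rewrite sub0r oppr_eq0 mulf_eq0 (negPf ud) => /eqP.
have nZtheta : ~ Z theta by case=> _; rewrite form_root // => /eqP;
  rewrite pnatr_eq0.
(* Otherwise [mu] would be orthogonal to every simple root, hence to itself. *)
have [a0 [a0P Za0]] : exists a, a \in Pi /\ Z a.
  apply: contrapT => na; have := form_root muD; rewrite form_cf big_seq big1.
    by move/eqP; rewrite eq_sym pnatr_eq0.
  move=> a aP; rewrite ZorthN ?mulr0 ?simple_root // => Za; by apply: na;
    exists a.
pose zz a := `[< Z a >].
(* The part of [theta] on the simple roots in [Z] is orthogonal to [theta] and to the other part,
   hence zero, although its coefficient at [a0] is at least 1. *)
pose w := \sum_(a <- Pi | zz a) cf a theta *: a.
pose w' := \sum_(a <- Pi | ~~ zz a) cf a theta *: a.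
have wE : theta = w + w' by rewrite {1}[theta]cf_expand (bigID zz).
have wth : form w theta = 0.
  by rewrite form_suml big1 // => a /asboolP[_ h _]; rewrite formZl h mulr0.
have ww' : form w w' = 0.
  rewrite form_suml big1 // => a /asboolP Za; rewrite formZl formC form_suml.
  rewrite big_seq_cond big1 ?mulr0 // => c /andP[cP /asboolP nc].
  by rewrite formZl ZorthN ?mulr0 ?simple_root.
have w0 : w = 0.
  apply/eqP/negPn/negP => /form_gt0.
  by have : form w w = 0; [move: wth; rewrite wE formDr ww' addr0 | lra].
have := theta_cf a0P; have : cf a0 w = cf a0 theta.
  rewrite cf_sum big_mkcond (big_fsetD1 a0) //=
    /zz asboolT // cfZ (cf_simple a0P a0P).
  rewrite eqxx mulr1 big_seq big1 ?addr0 // => a; rewrite !inE => /andP[aa0 aP].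
  by rewrite cfZ (cf_simple a0P aP) eq_sym (negPf aa0) mulr0 if_same.
rewrite w0 -(scale0r 0) cfZ mul0r; lra.
Qed.

Lemma degree1_pairing_mu : exists2 u, degree1 u & form u mu = 1.
Proof.
have [u u1 umu] := degree1_nonorthogonal;
  have [h|h|h] := degree1_pairing u1 muD mu0.
- exists (refl mu u); first exact: refl_degree1.
  by rewrite refl_form // h opprK.
- by rewrite h eqxx in umu.
- by exists u.
Qed.

Definition ht v := \sum_(a <- Pi) cf a v.

Lemma htB u v : ht (u - v) = ht u - ht v.
Proof. by rewrite /ht -sumrB; apply: eq_bigr => a _; rewrite !cfE. Qed.

Lemma htZ k v : ht (k *: v) = k * ht v.
Proof. by rewrite /ht mulr_sumr; apply: eq_bigr => a _; rewrite cfZ. Qed.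

Lemma ht_simple a : a \in Pi -> ht a = 1.
Proof.
move=> aP; rewrite /ht (big_fsetD1 a) //=
  cf_simple // eqxx big_seq big1 ?addr0 //.
by move=> c; rewrite !inE => /andP[ca cP]; rewrite cf_simple // (negPf ca).
Qed.

Lemma ht_ge0 v : pos v -> 0 <= ht v.
Proof. by move/posP => vp; rewrite /ht big_seq sumr_ge0. Qed.

Lemma pos_form_cf v : pos v -> 0 < form v v ->
  exists a, [/\ a \in Pi, 0 < cf a v & 0 < form v a].
Proof.
move=> /posP vp; rewrite form_cf => v0.
have [/hasP[a aP /= va]|/hasPn nv] :=
  boolP (has (fun a => 0 < cf a v * form a v) Pi).
  have va' : 0 < cf a v.
    by rewrite lt0r vp // andbT; apply: contraTneq va => ->; rewrite mul0r ltxx.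
  by exists a; split=> //; rewrite formC -(pmulr_rgt0 _ va').
suff : \sum_(a <- Pi) cf a v * form a v <= 0 by rewrite leNgt v0.
by rewrite big_seq sumr_le0 // => a /nv; rewrite -leNgt.
Qed.

End Degree0.

(** * Existence of an incomparable pair with sum [theta + mu] *)

Definition decomposable mu := exists u v,
  [/\ degree1 u, degree1 v, u + v = theta + mu & incomp u v].

(** A vector of norm 4 is not an integral multiple of a root, whose norm is 2. *)
Lemma double_square_neq4 (m : int) : 0 <= m -> m <= 2 ->
  m%:~R * (m%:~R * 2) <> 4 :> R.
Proof.
move=> m0 m2; have [->|[->|->]] : m = 0 \/ m = 1 \/ m = 2 by lia.
all: lra.
Qed.

(** Let [u < v = dual1 mu u]. The difference [d] has norm 4 and is orthogonal to [theta] and [mu];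
    by dominance so is each simple root in its support. One of these, [a], pairs positively with
    [d], and replacing [u], [v] by [u + a], [v - a] lowers the height of [d] by 2. *)
Lemma dominant_decomposable mu : mu \in Delta -> form mu theta = 0 ->
  (forall a, a \in Pi -> form a theta = 0 -> 0 <= form a mu) -> decomposable mu.
Proof.
move=> muD mu0 dom.
(* Heights are real numbers, so the induction runs on a natural upper bound. *)
have descent n u : degree1 u -> form u mu = 1 -> pos (dual1 mu u - u) ->
    ht (dual1 mu u - u) < n%:R -> decomposable mu.
  elim: n u => [|n IHn] u u1 umu; first by move/ht_ge0; lra.
  have [v1 vmu] := dual1_degree1 muD mu0 u1 umu.
  move: (erefl (dual1 mu u)) v1 vmu; rewrite {2}/dual1.
  move: (dual1 mu u) => v vE v1 vmu.
  move: (erefl (v - u)); move: {-1}(v - u) => d dE0 d_pos hd.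
  have [uD uth] := degree1P u1; have [vD vth] := degree1P v1.
  have [uv _] : form u v = 0 /\ form u mu = 1.
    by have := @dual1_pairing mu muD mu0 u; rewrite /dual1 -vE; apply.
  have dd : form d d = 4 by rewrite -dE0 !formE !form_root // [form v u]formC
    uv; lra.
  have cf_ge0 c : c \in Pi -> 0 <= cf c d by move/posP: d_pos; apply.
  have [|a [aP da fda]] := pos_form_cf d_pos; first by rewrite dd; lra.
  have aD := simple_root aP.
  have zero_sum (f : E -> R) : (forall c, c \in Pi -> 0 <= cf c d * f c) ->
      \sum_(c <- Pi) cf c d * f c = 0 -> forall c, c \in Pi -> cf c d * f c = 0.
    move=> f0 s0 c cP; move: s0; rewrite (big_fsetD1 c) //= => /eqP.
    rewrite paddr_eq0 ?f0 //; first by case/andP => /eqP.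
    by rewrite big_seq sumr_ge0 // => e; rewrite !inE => /andP[_ /f0].
  have dth c : c \in Pi -> cf c d * form c theta = 0.
    apply: (zero_sum (form^~ theta)) => // [e eP|]; first
      by rewrite mulr_ge0 ?cf_ge0 ?theta_dominant.
    by rewrite -form_cf -dE0 !formE uth vth subrr.
  have dmu c : c \in Pi -> cf c d * form c mu = 0.
    apply: (zero_sum (form^~ mu)) => // [e eP|]; last
      by rewrite -form_cf -dE0 !formE umu vmu subrr.
    have /eqP := dth e eP; rewrite mulf_eq0 => /orP[/eqP ->|/eqP e0].
      by rewrite mul0r.
    by rewrite mulr_ge0 ?cf_ge0 ?dom.
  have ath : form a theta = 0.
    by have /eqP := dth a aP; rewrite mulf_eq0 gt_eqF //= => /eqP.
  have amu : form a mu = 0.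
    by have /eqP := dmu a aP; rewrite mulf_eq0 gt_eqF //= => /eqP.
  have uva : form v a + form u a = 0.
    rewrite -formDl vE subrK formDl [form theta a]formC [form mu a]formC.
    by rewrite ath amu addr0.
  have ua : form u a = -1.
    by move: fda uva; rewrite -dE0 !formE;
      case: (degree1_pairing u1 aD ath) => ->; lra.
  pose w := u + a.
  have w1 : degree1 w.
    by have := refl_degree1 aD ath u1; rewrite /refl ua scaleN1r opprK.
  have wmu : form w mu = 1 by rewrite formDl umu amu addr0.
  have [w1' wmu'] := dual1_degree1 muD mu0 w1 wmu.
  have d'E : dual1 mu w - w = d - 2 *: a.
    rewrite -dE0 vE /dual1 /w scaler_nat mulr2n !opprD !addrA.
    by rewrite [_ - a - u]addrAC.
  have wD := degree1P w1; have w'D := degree1P w1'.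
  case: (boolP (incomp w (dual1 mu w))) => [iw|].
    by exists w, (dual1 mu w); split; rewrite // /dual1 addrC subrK.
  (* If the order were reversed, both [d] and [2 a - d] would be nonnegative, so [d] would be an
     integral multiple of [a], against its norm 4. *)
  rewrite negb_and !negbK => /orP[|dN]; last first.
    apply: (IHn w) => //; rewrite d'E htB htZ (ht_simple aP).
    by move: hd; rewrite -[n.+1%:R]natr1; lra.
  rewrite -opprB d'E opprB => /posP dN.
  have dE : d = cf a d *: a.
    apply: form_eq_cf => // c cP ca; have := dN c cP; have := cf_ge0 c cP.
    by rewrite !cfE (cf_simple cP aP) (negPf ca) /=; lra.
  have := dN a aP; rewrite !cfE (cf_simple aP aP) eqxx /= => da2.
  have di : integral d.
    by rewrite -dE0; apply: integralD; [|apply: integralN];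
      exact: root_integral.
  have [m mE] := di a aP; move: dd; rewrite dE !formE form_root // mE => dd.
  have m2 : m <= 2 by rewrite -(ler_int R); move: da2; rewrite mE; lra.
  have m0 : 0 <= m by rewrite -(ler_int R) -mE ltW.
  by case: (double_square_neq4 m0 m2).
have [u u1 umu] := degree1_pairing_mu muD mu0.
have [v1 vmu] := dual1_degree1 muD mu0 u1 umu.
have archi x : exists n : nat, x < n%:R :> R.
  by exists (Num.truncn x).+1; exact: truncnS_gt.
case: (boolP (incomp u (dual1 mu u))) => [iu|].
  by exists u, (dual1 mu u); split; rewrite // /dual1 addrC subrK.
rewrite negb_and !negbK => /orP[h|h].
  have [n hn] := archi (ht (u - dual1 mu u)).
  by apply: (descent n (dual1 mu u)); rewrite ?dual1K.
have [n hn] := archi (ht (dual1 mu u - u)); exact: (descent n u).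
Qed.

(** The pairings of [u] and [v] with [a] lie in {-1, 0, 1} and have positive sum, so they differ by
    at most 1 and [refl_incomp] applies. *)
Lemma refl_decomposable mu a : mu \in Delta -> a \in Pi -> form a theta = 0 ->
  0 < form mu a -> decomposable mu -> decomposable (refl a mu).
Proof.
move=> muD aP a0 mua [u [v [u1 v1 uv iuv]]]; have aD := simple_root aP.
exists (refl a u), (refl a v); split; try exact: refl_degree1.
  by rewrite -reflD uv reflD {1}/refl formC a0 scale0r subr0.
have [uD _] := degree1P u1; have [vD _] := degree1P v1.
apply: refl_incomp => //; rewrite formDl formNl.
have : form u a + form v a = form mu a
  by rewrite -formDl uv formDl [form theta a]formC a0 add0r.
case: (degree1_pairing u1 aD a0) => ->;
  case: (degree1_pairing v1 aD a0) => -> h.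
all: try (exfalso; lra).
- by constructor 1; rewrite sub0r.
- by constructor 3; rewrite subr0.
- by constructor 2; rewrite subrr.
Qed.

Lemma root_decomposable mu : mu \in Delta -> form mu theta = 0 ->
  decomposable mu.
Proof.
(* Reflecting in a degree 0 simple root with negative pairing raises [mu], so fewer roots remain
   above it; where no such simple root exists, [mu] is dominant. *)
pose higher mu := [fset nu in Delta | ht mu < ht nu].
have [n] := ubnP #|` higher mu|; elim: n mu => // n IHn mu hn muD mu0.
have [/hasP[a aP /andP[/eqP a0 amu]]|/hasPn nlow] :=
  boolP (has (fun a => (form a theta == 0) && (form a mu < 0)) Pi); last first.
  apply: dominant_decomposable => // a aP a0; have := nlow a aP.
  by rewrite a0 eqxx -leNgt.
have aD := simple_root aP; have nuD := refl_root aD muD.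
rewrite -(reflK aD mu); apply: refl_decomposable => //.
  by rewrite refl_form // formC; lra.
have ht_nu : ht mu < ht (refl a mu).
  by rewrite /refl htB htZ (ht_simple aP) formC; nra.
have nu0 : form (refl a mu) theta = 0 by rewrite /refl !formE a0 mu0; lra.
apply: (IHn _ _ nuD nu0); rewrite -ltnS; apply: leq_ltn_trans hn.
apply: fproper_ltn_card; rewrite fproperE; apply/andP; split.
  apply/fsubsetP => nu; rewrite !inE => /andP[-> /= h]; exact: lt_trans h.
by apply/fsubsetPn; exists (refl a mu); rewrite !inE nuD ?ltxx.
Qed.

(** * Counting the splittings of a positive root *)

Lemma form_le2 u v : u \in Delta -> v \in Delta -> form u v <= 2.
Proof.
move=> uD vD; have [->|uv] := eqVneq u v; first by rewrite form_root.
by have := form_le1 uD vD uv; lra.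
Qed.

Lemma pos_simple a : a \in Pi -> pos a.
Proof. by move=> aP; apply/posP => c cP; rewrite cf_simple. Qed.

Lemma pos_neqN u v : u \in Delta -> pos u -> pos v -> u != - v.
Proof.
move=> uD up vp; apply: contraNneq (root_neq0 uD) => uE.
by rewrite (pos_anti up) // uE opprK.
Qed.

(** The members of splittings rather than the pairs: each splitting is counted twice. *)
Definition splits nu := [fset u in Delta |
  [&& pos u, nu - u \in Delta, pos (nu - u) & incomp u (nu - u)]].

Lemma splitsP nu u : reflect
  [/\ u \in Delta, pos u, nu - u \in Delta, pos (nu - u) & incomp u (nu - u)]
  (u \in splits nu).
Proof.
rewrite !inE /=; apply: (iffP andP) => [[uD /and4P[]]|[uD h1 h2 h3 h4]] //.
by split=> //; apply/and4P.
Qed.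

Lemma splits_sub nu u : u \in splits nu -> nu - u \in splits nu.
Proof.
have uE : nu - (nu - u) = u by rewrite opprB addrC subrK.
by case/splitsP => h1 h2 h3 h4 h5; apply/splitsP; rewrite uE incompC.
Qed.

(** Neither part is [a], so both stay positive; their pairings with [a] sum to 1 or -1, so one is 0
    and the difference is 1 or -1. *)
Lemma splits_refl nu a u : a \in Pi -> form nu a = 1 \/ form nu a = -1 ->
  u \in splits nu -> u != a -> nu - u != a -> refl a u \in splits (refl a nu).
Proof.
move=> aP nua /splitsP[uD up vD vp iuv] ua va; have aD := simple_root aP.
have pa := pos_simple aP.
apply/splitsP; rewrite -reflB; split; try exact: refl_pos; try exact: refl_root.
apply: refl_incomp => //.
have := root_pairing uD aD ua (pos_neqN uD up pa).
have := root_pairing vD aD va (pos_neqN vD vp pa).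
have -> : form (u - (nu - u)) a = form u a - form (nu - u) a
  by rewrite formDl formNl.
have : form u a + form (nu - u) a = form nu a by rewrite -formDl addrC subrK.
move=> s; case=> v1; case=> u1; rewrite u1 v1; rewrite u1 v1 in s.
all: try (exfalso; case: nua; lra).
- by constructor 3; lra.
- by constructor 1; lra.
- by constructor 3; lra.
- by constructor 1; lra.
Qed.

Section SplitStep.
Variables nu a : E.
Hypotheses (nuD : nu \in Delta) (nup : pos nu).
Hypotheses (aP : a \in Pi) (nua : form nu a = -1).

Let aD : a \in Delta := simple_root aP.

(** [nu] is not below [a], since it would be a nonnegative multiple of [a]; by integrality it is
    above [a] exactly when [a] is in its support. *)
Lemma incomp_simple : incomp a nu = (cf a nu == 0).
Proof.
have n0 : 0 <= cf a nu by move/posP: nup; apply.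
have -> : incomp a nu = ~~ pos (nu - a).
  rewrite /incomp andb_idl // => _; apply/negP => /posP h.
  have nuE : nu = cf a nu *: a.
    apply: form_eq_cf => // c cP ca; have := h c cP;
      move/posP: nup => /(_ c cP).
    by rewrite !cfE (cf_simple cP aP) (negPf ca) /=; lra.
  by move: nua; rewrite nuE formZl form_root //; lra.
apply/negP/eqP => [h|h /posP/(_ a aP)]; last first.
  by rewrite !cfE (cf_simple aP aP) eqxx h /=; lra.
apply/eqP/negPn/negP => n1; apply: h; apply/posP => c cP.
rewrite !cfE (cf_simple cP aP); have [->|ca] := eqVneq c a; last first.
  by rewrite subr0; move/posP: nup; apply.
rewrite subr_ge0; apply: cf_ge1 => //; first exact: root_integral.
by rewrite lt0r n1.
Qed.

(** [nu - a] has pairing 3 with the root [- a], so it is not a root. *)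
Lemma simple_notin_splits : a \notin splits nu /\ nu - a \notin splits nu.
Proof.
suff naD : nu - a \notin Delta.
  by split; apply/negP => /splitsP[h1 _ h2 _ _]; case/negP: naD.
apply/negP => naD; have := form_le2 naD (rootN aD).
by rewrite !formE form_root // nua; lra.
Qed.

Lemma splits_step : splits (nu + a) =
  [fset refl a u | u in splits nu] `|`
  (if cf a nu == 0 then [fset a; nu] else fset0).
Proof.
have rE : refl a nu = nu + a by rewrite /refl nua scaleN1r opprK.
have nuaE : form (nu + a) a = 1 by rewrite formDl nua form_root //; lra.
have aS : (a \in splits (nu + a)) = (cf a nu == 0).
  rewrite -incomp_simple; apply/splitsP/idP => [[_ _ _ _]|i]; rewrite addrK //.
  by split=> //; exact: pos_simple.
have [aN naN] := simple_notin_splits.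
apply/fsetP => u; rewrite in_fsetU; apply/idP/orP => [uS|[|]].
- have [ua|ua] := eqVneq u a.
    by right; move: uS; rewrite ua aS => ->; rewrite !inE eqxx.
  have [va|va] := eqVneq (nu + a - u) a.
    right; have un : u = nu by apply/eqP;
      rewrite -subr_eq0 -opprB oppr_eq0 -(inj_eq (addIr a)) add0r addrAC va.
    by move: (splits_sub uS); rewrite va aS => ->; rewrite un !inE eqxx orbT.
  left; apply/imfsetP; exists (refl a u) => /=; last by rewrite reflK.
  by have := splits_refl aP (or_introl nuaE) uS ua va; rewrite -rE reflK.
- case/imfsetP => v /= vS ->; rewrite -rE; apply: splits_refl => //; first
  by right.
    by apply: contraNneq aN => <-.
  apply: contraNneq naN => <-; by rewrite opprB addrC subrK.
case: ifP => // c0; rewrite in_fset2 => /orP[/eqP->|/eqP->]; rewrite ?aS ?c0 //.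
rewrite -[X in X \in _](addrK a nu); apply: splits_sub; by rewrite aS c0.
Qed.

Lemma card_splits_step :
  #|` splits (nu + a)| = (#|` splits nu| + 2 * (cf a nu == 0%R))%N.
Proof.
have aneq : a != nu.
  by apply/eqP => h; move: nua; rewrite -h form_root //; lra.
rewrite splits_step cardfsU.
have -> : #|` [fset refl a u | u in splits nu]| = #|` splits nu|.
  by rewrite card_imfset //; exact: (inv_inj (reflK aD)).
case: ifP => c0; last by rewrite fsetI0 !cardfs0 subn0.
rewrite cardfs2 aneq (_ : _ `&` _ = fset0) ?cardfs0 ?subn0 //.
(* A reflected member equal to [a] or [nu] would come from a splitting with [- a] as one part. *)
apply/fsetP => u; rewrite !inE;
  apply/negP => /andP[/imfsetP[v /= /splitsP[vD vp wD wp _] ->]].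
case/orP => /eqP h.
  have := pos_neqN vD vp (pos_simple aP); rewrite -[v](reflK aD) h refl_self //.
  by rewrite eqxx.
have vE : v = nu + a by rewrite -[v](reflK aD) h /refl nua scaleN1r opprK.
by have := pos_neqN wD wp (pos_simple aP);
  rewrite vE opprD addrA subrr add0r eqxx.
Qed.

End SplitStep.

Definition supp nu := [fset a in Pi | cf a nu != 0].

Lemma card_supp_step nu a : a \in Pi -> pos nu ->
  #|` supp (nu + a)| = (#|` supp nu| + (cf a nu == 0%R))%N.
Proof.
move=> aP /posP nup; have -> : supp (nu + a) = a |` supp nu.
  apply/fsetP => c; rewrite !inE /=; have [->|ca] := eqVneq c a.
    by rewrite aP /= cfD (cf_simple aP aP) eqxx /= gt_eqF //; have := nup a aP;
      lra.
  by case: (boolP (c \in Pi)) => //= cP;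
    rewrite cfD (cf_simple cP aP) (negPf ca) addr0.
by rewrite cardfsU1 !inE aP /= negbK addnC.
Qed.

(** Twice the count [#(supp nu) - 1], written without truncated subtraction. The induction on height
    removes a simple root with pairing 1, down to a simple root, which has no splittings. *)
Lemma card_splits nu : nu \in Delta -> pos nu ->
  (#|` splits nu| + 2 = 2 * #|` supp nu|)%N.
Proof.
have [n hn] : exists n : nat, ht nu < n%:R.
  by exists (Num.truncn (ht nu)).+1; exact: truncnS_gt.
elim: n nu hn => [|n IHn] nu hn nuD nup; first by exfalso; have := ht_ge0 nup;
  lra.
have [|a [aP nua fa]] := pos_form_cf nup; first by rewrite form_root.
have aD := simple_root aP; have pa := pos_simple aP.
have [->|na] := eqVneq nu a.
  have -> : splits a = fset0.
    apply/fsetP => u; rewrite in_fset0;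
      apply/negP => /splitsP[uD /posP up vD /posP vp _].
    have h c : c \in Pi -> c != a -> cf c u = 0.
      move=> cP ca; have := up c cP; have := vp c cP.
      by rewrite !cfE (cf_simple cP aP) (negPf ca) /=; lra.
    have uE := form_eq_cf aP h.
    have : cf a (a - u) <= 0.
      have u1 : 0 < cf a u.
        rewrite lt0r up // andbT; apply: contraNneq (root_neq0 uD) => u0.
        by rewrite uE u0 scale0r.
      have := cf_ge1 (root_integral uD) aP u1.
      by rewrite !cfE (cf_simple aP aP) eqxx /=; lra.
    move=> h2; have v0 : cf a (a - u) = 0 by have := vp a aP; lra.
    have := root_neq0 vD;
    rewrite (@form_eq_cf (a - u) a) ?v0 ?scale0r ?eqxx // => c cP ca.
    by rewrite !cfE h // (cf_simple cP aP) (negPf ca) subrr.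
  have -> : supp a = [fset a]; last by rewrite cardfs1 cardfs0.
  apply/fsetP => c; rewrite !inE /=; case: (boolP (c \in Pi)) => [cP|cN] /=.
    by rewrite (cf_simple cP aP) pnatr_eq0 eqb0 negbK.
  by symmetry; apply: contraNF cN => /eqP ->.
have f1 : form nu a = 1.
  case: (root_pairing nuD aD na (pos_neqN nuD nup pa)) => // h; move: fa;
    rewrite h; lra.
pose nu0 := nu - a; have nuE : nu = nu0 + a by rewrite subrK.
have nu0E : nu0 = refl a nu by rewrite /refl f1 scale1r.
have nu0D : nu0 \in Delta by rewrite nu0E refl_root.
have nu0p : pos nu0 by rewrite nu0E refl_pos.
have nu0a : form nu0 a = -1 by rewrite nu0E refl_form // f1.
have hn0 : ht nu0 < n%:R.
  by rewrite /nu0 htB (ht_simple aP); move: hn; rewrite -[n.+1%:R]natr1; lra.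
move: (IHn nu0 hn0 nu0D nu0p);
  rewrite nuE card_splits_step // card_supp_step //.
move: (#|` splits nu0|) (#|` supp nu0|) (nat_of_bool _) => x y z xy.
by rewrite mulnDr -xy addnAC.
Qed.

Lemma card_splits_theta : (#|` splits theta| + 2 = 2 * #|` Pi|)%N.
Proof.
have th_pos : pos theta.
  by apply/posP => a aP; have := theta_cf aP; lra.
rewrite card_splits //; congr (2 * #|` _|)%N; apply/fsetP => a; rewrite !inE /=.
case: (boolP (a \in Pi)) => //= aP; apply/eqP; have := theta_cf aP; lra.
Qed.

(** * Two-element antichains of degree one *)

Lemma in_fset_filter (T : choiceType) (F : {fset T}) (P : pred T) x :
  (x \in [fset y in F | P y]) = (x \in F) && P x.
Proof. by rewrite !inE. Qed.

Lemma degree1E u : (u \in graded_roots ip Delta theta 1) = degree1 u.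
Proof.
apply/gradedP/andP => -[uD]; first by move->.
by move/eqP.
Qed.

Lemma degree0P u : reflect (u \in Delta /\ form u theta = 0)
  (u \in graded_roots ip Delta theta 0).
Proof. by apply: (iffP (gradedP 0 u)) => -[uD ->]. Qed.

(** [v - u] is orthogonal to [theta], which is dominant, so a nonnegative [v - u] involves only
    simple roots of degree 0. *)
Lemma root_leP u v : degree1 u -> degree1 v ->
  root_le ip Delta Pi theta u v <-> pos (v - u).
Proof.
move=> /degree1P[uD u1] /degree1P[vD v1]; split=> [[c ->]|].
  apply/posP => a aP; rewrite cf_sum big_seq sumr_ge0 // => d.
  by rewrite in_fsetI => /andP[dP _];
    rewrite -scaler_nat cfZ (cf_simple aP dP) mulr_ge0.
move=> dp; exists (fun a => Num.truncn (cf a (v - u))); set d := v - u in dp *.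
have cf_ge0 c : c \in Pi -> 0 <= cf c d by move/posP: dp; apply.
have dth : form d theta = 0 by rewrite formDl formNl u1 v1 subrr.
have di : integral d.
  by apply: integralD; [|apply: integralN]; exact: root_integral.
have termE a : a \in Pi -> a *+ Num.truncn (cf a d) = cf a d *: a.
  move=> aP; rewrite -scaler_nat truncnK //.
  have [m mE] := di a aP; rewrite mE natrEint intr_int /=.
  by rewrite -mE cf_ge0.
rewrite {1}[d]cf_expand.
transitivity (\sum_(a <- Pi `&` graded_roots ip Delta theta 0) cf a d *: a);
  last first.
  by apply: eq_big_seq => a; rewrite in_fsetI => /andP[aP _]; rewrite termE.
symmetry; apply: big_fset_incl; first exact: fsubsetIl.
move=> a aP; rewrite in_fsetI aP /= => /degree0P a0.
suff -> : cf a d = 0 by rewrite scale0r.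
apply/eqP/negPn/negP => da; move: dth; rewrite form_cf (big_fsetD1 a) //=.
move/eqP; rewrite paddr_eq0.
- rewrite mulf_eq0 (negPf da) /= => /andP[/eqP ath _].
  by apply: a0; rewrite simple_root.
- by rewrite mulr_ge0 ?cf_ge0 ?theta_dominant.
rewrite big_seq sumr_ge0 // => c; rewrite !inE => /andP[_ cP].
by rewrite mulr_ge0 ?cf_ge0 ?theta_dominant.
Qed.

Local Notation AC2 := (antichains2 ip Delta Pi theta).

Lemma antichains2P A : reflect
  (exists u v, [/\ A = [fset u; v], degree1 u, degree1 v & incomp u v])
    (A \in AC2).
Proof.
rewrite !inE /= fpowersetE; apply: (iffP and3P) => [[sA /asboolP[_ antiA]]|].
  move=> /eqP A2; have : A != fset0 by rewrite -cardfs_gt0 A2.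
  case/fset0Pn => u uA; have : #|` A `\ u| == 1%N.
    by move: A2; rewrite (cardfsD1 u A) uA add1n => -[->].
  case/cardfs1P => v vE.
  have [vu vA] : v != u /\ v \in A.
    by apply/andP; rewrite -in_fsetD1 vE inE.
  have [u1 v1] : degree1 u /\ degree1 v.
    by rewrite -!degree1E; split; apply: (fsubsetP sA).
  exists u, v; split=> //; first by rewrite -(fsetD1K uA) vE.
  rewrite /incomp; apply/andP; split; apply/negP => h.
    by case/eqP: vu; apply: antiA => //; apply/root_leP.
  by case/eqP: vu; symmetry; apply: antiA => //; apply/root_leP.
case=> u [v [-> u1 v1 iuv]]; have uv := incomp_neq iuv.
have sA : [fset u; v] `<=` graded_roots ip Delta theta 1.
  by apply/fsubsetP => x /fset2P[]->; rewrite degree1E.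
split=> //; last by rewrite cardfs2 uv.
apply/asboolP; split=> // x y /fset2P[]-> /fset2P[]-> // /root_leP.
  by move=> /(_ u1 v1) h; case/andP: iuv; rewrite h.
by move=> /(_ v1 u1) h; case/andP: iuv; rewrite h.
Qed.

Lemma sum_fset2 (u v : E) : u != v -> \sum_(x <- [fset u; v]) x = u + v :> E.
Proof. by move=> uv; rewrite big_fsetU1 ?inE //= big_seq_fset1. Qed.

Lemma antichain_map2 u v : incomp u v ->
  antichain_map theta [fset u; v] = u + v - theta.
Proof. by move/incomp_neq => uv; rewrite /antichain_map sum_fset2. Qed.

(** For pairing -1, [u + v] is a root of degree 2, that is [theta]; for 0, [u - (theta - v)] is a
    root; pairing 1 would make [u] and [v] comparable. *)
Lemma antichain_map_root u v : degree1 u -> degree1 v -> incomp u v ->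
  u + v - theta = 0 \/ u + v - theta \in graded_roots ip Delta theta 0.
Proof.
move=> u1 v1 iuv; have [uD uth] := degree1P u1; have [vD vth] := degree1P v1.
have [h|h|h] := degree1_pairing1 u1 v1 (incomp_neq iuv).
- left; apply/eqP; rewrite subr_eq0; apply/eqP/form_eq2 => //.
    exact: root_add.
  by rewrite formDl; lra.
- right; have tvD : theta - v \in Delta by rewrite root_sub // formC.
  apply/degree0P; split; last by rewrite !formE form_root //; lra.
  have -> : u + v - theta = u - (theta - v) by rewrite opprB addrA.
  by apply: root_sub => //; rewrite !formE h uth subr0.
by case/negP: (comparable_root (root_sub uD vD h)).
Qed.

Lemma antichain_mapP A : A \in AC2 ->
  antichain_map theta A \in 0 |` graded_roots ip Delta theta 0.
Proof.
case/antichains2P => u [v [-> u1 v1 iuv]]; rewrite antichain_map2 // in_fset1U.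
by have [->|->] := antichain_map_root u1 v1 iuv; rewrite ?eqxx ?orbT.
Qed.

Lemma antichain_exists mu : mu \in graded_roots ip Delta theta 0 ->
  exists A : {fset E}, A \in AC2 /\ antichain_map theta A = mu.
Proof.
case/degree0P => muD mu0.
have [u [v [u1 v1 uv iuv]]] := root_decomposable muD mu0.
exists [fset u; v]; split; first by apply/antichains2P; exists u, v.
by rewrite antichain_map2 // uv addrC addKr.
Qed.

Lemma antichain_unique mu A B : mu \in graded_roots ip Delta theta 0 ->
  A \in AC2 -> antichain_map theta A = mu ->
  B \in AC2 -> antichain_map theta B = mu -> A = B.
Proof.
case/degree0P => muD mu0.
have dualE u v : u + v - theta = mu -> v = dual1 mu u.
  by move=> <-; rewrite /dual1 [theta + _]addrC subrK addrC addKr.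
case/antichains2P => u [v [-> u1 v1 iuv]];
  rewrite antichain_map2 // => /dualE vE.
case/antichains2P => x [y [-> x1 y1 ixy]];
  rewrite antichain_map2 // => /dualE yE.
rewrite {}vE {}yE in v1 iuv y1 ixy *.
have [_ umu] := dual1_pairing muD mu0 u1 v1;
  have [_ xmu] := dual1_pairing muD mu0 x1 y1.
have [->//|->] := dual1_incomp_unique muD mu0 u1 umu x1 xmu iuv ixy.
by rewrite dual1K fsetUC.
Qed.

Lemma antichain_orthogonal mu u v : mu \in graded_roots ip Delta theta 0 ->
  [fset u; v] \in AC2 -> u + v - theta = mu -> ip u v = 0.
Proof.
case/degree0P => muD mu0 /antichains2P[x [y [xyE x1 y1 ixy]]] uvmu.
have uv1 : degree1 u /\ degree1 v.
  have h z : z \in [fset u; v] -> degree1 z by rewrite xyE => /fset2P[]->.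
  by split; apply: h; rewrite ?fset21 ?fset22.
case: uv1 => u1 v1; have vE : v = dual1 mu u.
  by rewrite -uvmu /dual1 [theta + _]addrC subrK addrC addKr.
rewrite vE in v1 *; have [/eqP + _] := dual1_pairing muD mu0 u1 v1.
rewrite /form !mulf_eq0 invr_eq0 (gt_eqF theta_norm_gt0) orbF pnatr_eq0 /=.
by move/eqP.
Qed.

Definition theta_antichains := [fset A in AC2 | \sum_(u <- A) u == theta].

(** Degree 1 roots are positive because [theta] is dominant. Conversely, the parts of a splitting
    have degree at most 1 with sum 2, hence degree 1. *)
Lemma theta_antichainsP A : reflect
  (exists2 u, u \in splits theta & A = [fset u; theta - u])
  (A \in theta_antichains).
Proof.
rewrite in_fset_filter.
apply: (iffP andP) => [[/antichains2P[u [v [-> u1 v1 iuv]]]]|[u]].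
  rewrite sum_fset2 ?incomp_neq // => /eqP uv.
  have vE : v = theta - u by rewrite -uv addrC addKr.
  have [[uD uth] [vD vth]] := (degree1P u1, degree1P v1).
  have dpos w : w \in Delta -> form w theta = 1 -> pos w.
    move=> wD wth; have [//|wn] := root_pos wD; exfalso.
    have : form (- w) theta >= 0.
      rewrite form_cf big_seq sumr_ge0 // => a aP.
      by rewrite mulr_ge0 ?theta_dominant //; move/posP: wn; apply.
    by rewrite formNl wth; lra.
  exists u; last by rewrite -vE.
  by apply/splitsP; rewrite -vE; split=> //; exact: dpos.
case/splitsP => uD up vD vp iuv ->.
have lt1 w : w \in Delta -> theta - w \in Delta -> form w theta <= 1.
  move=> wD w'D; apply: form_le1 => //; apply: contraNneq (root_neq0 w'D) => ->.
  by rewrite subrr.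
have thuE : theta - (theta - u) = u by rewrite opprB addrC subrK.
have h1 := lt1 u uD vD; have := lt1 (theta - u) vD; rewrite thuE => /(_ uD) h2.
have h3 : form (theta - u) theta = 2 - form u theta
  by rewrite formDl formNl form_root.
split; last by rewrite sum_fset2 ?incomp_neq // addrC subrK.
apply/antichains2P; exists u, (theta - u); split=> //; apply/andP; split=> //.
  by apply/eqP; lra.
by apply/eqP; lra.
Qed.

Lemma card_theta_antichains : #|` theta_antichains| = (#|` Pi| - 1)%N.
Proof.
suff : (#|` splits theta| = 2 * #|` theta_antichains|)%N.
  have := card_splits_theta; move: (#|` splits theta|) => x; lia.
have -> : theta_antichains = [fset [fset u; theta - u] | u in splits theta].
  apply/fsetP => A; apply/theta_antichainsP/imfsetP => /= -[u us ->];
    by exists u.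
(* Each antichain comes from exactly two members, [u] and [theta - u]. *)
rewrite card_fset_sum1 (partition_big_imfset _ (fun u => [fset u; theta - u]))
  /=.
rewrite card_fset_sum1 big_distrr /=;
  apply: eq_big_seq => A /imfsetP[u /= us ->].
have /incomp_neq uv : incomp u (theta - u) by case/splitsP: us.
rewrite muln1 big_fset_condE -card_fset_sum1.
rewrite -[RHS](_ : #|` [fset u; theta - u]| = _);
  last by rewrite cardfs2 uv.
congr #|` _|; apply/fsetP => v; rewrite in_fset_filter /=;
  apply/andP/idP => [[_ /eqP <-]|].
  exact: fset21.
case/fset2P => ->; first by rewrite us eqxx.
have thuE : theta - (theta - u) = u by rewrite opprB addrC subrK.
by rewrite splits_sub // thuE fsetUC eqxx.
Qed.

(** Count the fibres of [antichain_map]: [rk - 1] antichains over 0 and exactly one over each root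
    of degree 0. *)
Lemma card_antichains2 :
  #|` AC2| = (#|` Pi| - 1 + #|` graded_roots ip Delta theta 0|)%N.
Proof.
have n0 : 0 \notin graded_roots ip Delta theta 0.
  by apply/degree0P => -[/root_neq0]; rewrite eqxx.
have fiber (A : {fset E}) : A \in AC2 ->
    1%N = (\sum_(nu <- (0%R : E) |` graded_roots ip Delta theta 0)
      (antichain_map theta A == nu))%N.
  move=> /antichain_mapP mA;
    rewrite (big_fsetD1 _ mA) /= eqxx big_seq big1 ?addn0 //.
  by move=> nu; rewrite !inE => /andP[/negPf h _]; rewrite eq_sym h.
rewrite card_fset_sum1 (eq_big_seq _ fiber) exchange_big /= big_fsetU1 //=.
have cardE nu : (\sum_(A <- AC2) (antichain_map theta A == nu))%N =
    #|` [fset A in AC2 | antichain_map theta A == nu]|.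
  transitivity (\sum_(A <- AC2 | antichain_map theta A == nu) 1)%N.
    by rewrite [RHS]big_mkcond; apply: eq_bigr => A _; case: (_ == _).
  by rewrite big_fset_condE -card_fset_sum1.
congr (_ + _)%N.
  rewrite cardE -card_theta_antichains; congr #|` _|; apply/fsetP => A;
    rewrite !in_fset_filter /=.
  by rewrite /antichain_map subr_eq0.
rewrite card_fset_sum1; apply: eq_big_seq => mu muD0; rewrite cardE.
have [A [AC Amu]] := antichain_exists muD0.
have -> : [fset A in AC2 | antichain_map theta A == mu] = [fset A]; last
  by rewrite cardfs1.
apply/fsetP => B; rewrite in_fset1 in_fset_filter /=;
  apply/andP/eqP => [[BC /eqP Bmu]|->].
  exact: antichain_unique muD0 BC Bmu AC Amu.
by rewrite AC Amu.
Qed.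

End SimplyLaced.

Local Open Scope complex_scope.

Theorem theorem4p9
  (R : realType) (g : vectType R[i]) (br : g -> g -> g) (t : {vspace g})
  (E : vectType R) (ip : E -> E -> R) (Delta : {fset E}) (wt : E -> dual R[i] t)
  (Pi : {fset E}) (theta : E)
  (hg : simple_lie_algebra br)
  (ht : cartan_subalgebra br t)
  (hip : inner_product ip)
  (hDelta : root_system ip Delta)
  (hwt : roots_of_lie_algebra br Delta wt)
  (hPi : simple_roots Delta Pi)
  (htheta : highest_root Delta Pi theta)
  (hADE : simply_laced ip Delta) :
  let Delta0 := graded_roots ip Delta theta 0 in
  let AC2 := antichains2 ip Delta Pi theta in
  let rk := #|` Pi| in
  [/\ (* (i) *)
      forall mu : E, mu \in Delta0 ->
        (exists! A : {fset E}, A \in AC2 /\ antichain_map theta A = mu) /\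
        (forall g1 g2 : E, [fset g1; g2] \in AC2 -> g1 + g2 - theta = mu ->
           ip g1 g2 = 0),
      (* (ii) *)
      #|` [fset A in AC2 | \sum_(u <- A) u == theta]| = (rk - 1)%N,
      (* the map is well defined *)
      forall A : {fset E}, A \in AC2 -> antichain_map theta A \in 0 |` Delta0,
      (* the map is onto; for rk = 1 there are no antichains at all *)
      (1 < rk)%N -> forall nu : E, nu \in 0 |` Delta0 ->
        exists2 A : {fset E}, A \in AC2 & antichain_map theta A = nu
    & #|` AC2| = (\dim (lie_degree0 ip br Delta wt theta) - 1)%N].
Proof.
move=> Delta0 AC2 rk.
have [n [b [w [bb bw]]]] := weight_basis hg ht.
have dimE := dim_lie_degree0 theta hg ht hDelta hwt hPi bb bw.
have cardE := card_antichains2 hip hDelta hPi htheta hADE.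
have th_card := card_theta_antichains hip hDelta hPi htheta hADE.
have ex := antichain_exists hip hDelta hPi htheta hADE.
(* Positive rank lets the truncated subtraction of 1 be moved across the sum in the final count. *)
have rk_gt0 : (0 < rk)%N.
  have := card_splits_theta hip hDelta hPi htheta hADE; rewrite -/rk; lia.
split.
- move=> mu muD0; split; last first.
    by move=> g1 g2; apply: (antichain_orthogonal hip hDelta hPi htheta hADE
      muD0).
  have [A [AC Amu]] := ex mu muD0; exists A; split=> // B [BC Bmu].
  exact: (antichain_unique hip hDelta hPi htheta hADE muD0 AC Amu BC Bmu).
- exact: th_card.
- exact: (antichain_mapP hip hDelta hPi htheta hADE).
- move=> rk1 nu; rewrite in_fset1U => /orP[/eqP ->|/ex[A []]]; last by exists A.
  have : (0 < #|` theta_antichains ip Delta Pi theta|)%N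
    by rewrite th_card subn_gt0.
  rewrite cardfs_gt0 => /fset0Pn[A];
    rewrite in_fset_filter => /andP[AC /eqP sA].
  by exists A; rewrite // /antichain_map sA subrr.
- by rewrite dimE cardE -/rk -/Delta0 addnBAC.
Qed.
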